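(* Let $1<p<r<2$. There are constants $c_1,c_2,a_{r,p},b_{r,p},D_{r,p}>0$ depending only on $r$ and $p$ such that the following holds. Let $n\in\mathbb N$, let $y\in\mathbb R^n\setminus\{0\}$ with $y_1\ge\dots\ge y_n\ge 0$, and let $x_i=(n/i)^{1/r}$ for $i=1,\dots,n$ and $z_j=(n/j)^{1/p}$ for $j=1,\dots,n$. Then there is an Orlicz function $M_y$ satisfying, for all $\ell=1,\dots,n$, $$c_1\,M_y^{*-1}\!\left(\frac{\ell}{n}\right)\le \frac1n\sum_{i=1}^{\ell}y_i+\left(\frac{\ell}{n}\right)^{1/p^*}\left(\frac1n\sum_{i=\ell+1}^n |y_i|^p\right)^{1/p}\le c_2\,M_y^{*-1}\!\left(\frac{\ell}{n}\right),$$ such that for all real matrices $a=(a_{ij})_{i,j=1}^n$ $$a_{r,p}\,\Big\|\big(\|(a_{ij})_{i=1}^n\|_r\big)_{j=1}^n\Big\|_{M_y}\le \frac{1}{(n!)^3}\sum_{\pi,\sigma,\eta}\left(\sum_{i,j=1}^n\big|a_{ij}x_{\pi(i)}y_{\sigma(j)}z_{\eta(j)}\big|^2\right)^{1/2}\le b_{r,p}\,\Big\|\big(\|(a_{ij})_{i=1}^n\|_r\big)_{j=1}^n\Big\|_{M_y},$$ where the sum runs over all permutations $\pi,\sigma,\eta$ of $\{1,\dots,n\}$. In particular, $\ell_{M_y}^n(\ell_r^n)$ is $D_{r,p}$-isomorphic to a subspace of $L_1$.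
   Context: An Orlicz function is a convex function $M:[0,\infty)\to[0,\infty)$ with $M(0)=0$ and $M(t)>0$ for $t>0$; $\|x\|_M=\inf\{\rho>0:\sum_{i=1}^n M(|x_i|/\rho)\le1\}$ for $x\in\mathbb R^n$. Its dual function is $M^*(x)=\sup_{t\ge0}(xt-M(t))$, and $M^{*-1}$ denotes the inverse function of $M^*$ (for $t>0$, $M^{*-1}(t)=\sup\{s\ge0:M^*(s)\le t\}$). $\|\cdot\|_r$ is the $\ell_r^n$-norm, and $p^*$ is the conjugate exponent, $1/p+1/p^*=1$. The space $\ell_{M}^n(\ell_r^n)$ is the space of real $n\times n$ matrices with the norm $\|(\|(a_{ij})_{i=1}^n\|_r)_{j=1}^n\|_{M}$. Banach spaces $X$ and $Y$ are $C$-isomorphic if there is an isomorphism $I:X\to Y$ with $\|I\|\|I^{-1}\|\le C$. $L_1$ is the real space $L_1[0,1]$. Empty sums are $0$. *)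

(* Defs.v *)
From HB Require Import structures.
From mathcomp Require Import all_boot all_order all_algebra all_fingroup.
From mathcomp Require Import generic_quotient.
From mathcomp Require Import all_classical all_reals all_analysis.
From mathcomp Require Import measurable_realfun.
Set Implicit Arguments.
Unset Strict Implicit.
Unset Printing Implicit Defensive.
Import Order.TTheory GRing.Theory Num.Theory.
Import numFieldNormedType.Exports.
Local Open Scope classical_set_scope.
Local Open Scope ring_scope.

(** ** The vector space L_1(mu)

[LspaceType1 mu] is the library's type of classes, modulo equality
[mu]-almost everywhere, of integrable functions, but the library gives it
neither a vector space structure nor a norm. *)

Section L1_space.
Context d (T : measurableType d) (R : realType).
Variable mu : {measure set T -> \bar R}.

Definition L1 : Type := LspaceType1 mu.

Definition L1_fun (f : L1) : T -> R := (f : LspaceType1 mu) : aeEqMfun _ _.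

Definition L1_norm (f : L1) : R := fine ('N[mu]_1 [EFin \o L1_fun f])%E.

HB.instance Definition _ := gen_eqMixin L1.
HB.instance Definition _ := gen_choiceMixin L1.

Lemma L1_fun_Lfun (f : L1) : L1_fun f \in Lfun mu 1.
Proof.
rewrite inE; apply/andP; split.
  by rewrite inE /=; exact: (measurable_funPT (repr (LebesgueSpace.sort f))).
rewrite inE /=; exact: (@Lebesgue_finite _ _ _ _ _ _ f).
Qed.

Lemma L1_eqP (f g : L1) : f = g <-> (L1_fun f = L1_fun g %[ae mu]).
Proof.
split=> [->|fg]; first exact: ae_eq_refl.
suff E : LebesgueSpace.sort f = LebesgueSpace.sort g.
  case: f g E {fg} => [f [[p]]] [g [[q]]] /= E.
  by case: _ / E q => q; rewrite (Prop_irrelevance p q).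
rewrite -[LHS]reprK -[RHS]reprK; apply/eqmodP.
by apply/asboolP.
Qed.

Section of_Lfun.
Variables (h : T -> R) (hL : h \in Lfun mu 1).

Let hR : T -> measurableTypeR R := h.

Let measurable_hR : measurable_fun setT hR.
Proof. exact: (set_mem (sub_Lfun_mfun hL)). Qed.

HB.instance Definition _ := isMeasurableFun.Build _ _ _ _ hR measurable_hR.

Let mh : {mfun T >-> measurableTypeR R} := hR.

Let qh : {mfun_ mu, T >-> measurableTypeR R} := (\pi_({mfun_ mu, T >-> measurableTypeR R}) mh)%qT.

Let qhE : (qh : T -> R) = h %[ae mu].
Proof.
have /eqmodP/asboolP : (\pi_({mfun_ mu, T >-> measurableTypeR R}) (repr qh) = \pi_({mfun_ mu, T >-> measurableTypeR R}) mh)%qT.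
  by rewrite reprK.
by [].
Qed.

Let qh_finite : finite_norm mu 1 (qh : T -> R).
Proof.
have mhf : measurable_fun setT h := set_mem (sub_Lfun_mfun hL).
have fh : finite_norm mu 1 h := set_mem (sub_Lfun_finLfun hL).
move: fh.
rewrite /finite_norm !Lnorm1.
suff -> : (\int[mu]_x `|(EFin \o (qh : T -> R)) x| =
          \int[mu]_x `|(EFin \o h) x|)%E by [].
apply: ae_eq_integral => //.
- apply: measurableT_comp => //; apply/measurable_EFinP => //.
  exact: (measurable_funPT (repr qh)).
- by apply: measurableT_comp => //; exact/measurable_EFinP.
- by apply: filterS qhE => x /[apply] /= ->.
Qed.

HB.instance Definition _ := @isFinLebesgue.Build _ _ _ _ _ (lexx _) qh qh_finite.

Definition L1_of : L1 := (qh : LspaceType1 mu).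

Lemma L1_ofE : L1_fun L1_of = h %[ae mu].
Proof. exact: qhE. Qed.

End of_Lfun.


Let zero_Lfun : (cst 0 : T -> R) \in Lfun mu 1.
Proof. exact: (Lfun_addr_closed mu (lexx 1%E)).1. Qed.

Let add_Lfun (f g : L1) : (fun t => L1_fun f t + L1_fun g t) \in Lfun mu 1.
Proof. by apply: (Lfun_addr_closed mu (lexx 1%E)).2; exact: L1_fun_Lfun. Qed.

Let opp_Lfun (f : L1) : (fun t => - L1_fun f t) \in Lfun mu 1.
Proof. by apply: Lfun_oppr_closed; exact: L1_fun_Lfun. Qed.

Let scale_Lfun (a : R) (f : L1) : (fun t => a * L1_fun f t) \in Lfun mu 1.
Proof.
rewrite [X in X \in _](_ : _ = a \o* L1_fun f); last first.
  by apply/funext => t /=; rewrite mulrC.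
by apply: Lfun_scale => //; exact: L1_fun_Lfun.
Qed.

Definition L1_zero : L1 := L1_of zero_Lfun.
Definition L1_add (f g : L1) : L1 := L1_of (add_Lfun f g).
Definition L1_opp (f : L1) : L1 := L1_of (opp_Lfun f).
Definition L1_scale (a : R) (f : L1) : L1 := L1_of (scale_Lfun a f).

Let addE f g := L1_ofE (add_Lfun f g).
Let oppE f := L1_ofE (opp_Lfun f).
Let scaleE a f := L1_ofE (scale_Lfun a f).
Let zeroE := L1_ofE zero_Lfun.

Let L1_addA : associative L1_add.
Proof.
move=> f g h; apply/L1_eqP.
near=> t => _; rewrite (near (addE f (L1_add g h)) t)// (near (addE g h) t)//.
by rewrite (near (addE (L1_add f g) h) t)// (near (addE f g) t)// addrA.
Unshelve. all: by end_near. Qed.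

Let L1_addC : commutative L1_add.
Proof.
move=> f g; apply/L1_eqP.
by near=> t => _; rewrite (near (addE f g) t)// (near (addE g f) t)// addrC.
Unshelve. all: by end_near. Qed.

Let L1_add0 : left_id L1_zero L1_add.
Proof.
move=> f; apply/L1_eqP.
by near=> t => _; rewrite (near (addE L1_zero f) t)// (near zeroE t)// add0r.
Unshelve. all: by end_near. Qed.

Let L1_addN : left_inverse L1_zero L1_opp L1_add.
Proof.
move=> f; apply/L1_eqP; near=> t => _.
by rewrite (near (addE (L1_opp f) f) t)// (near (oppE f) t)// (near zeroE t)// addNr.
Unshelve. all: by end_near. Qed.

HB.instance Definition _ :=
  GRing.isZmodule.Build L1 L1_addA L1_addC L1_add0 L1_addN.

Let L1_scaleA a b f : L1_scale a (L1_scale b f) = L1_scale (a * b) f.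
Proof.
apply/L1_eqP; near=> t => _.
rewrite (near (scaleE a (L1_scale b f)) t)// (near (scaleE b f) t)//.
by rewrite (near (scaleE (a * b) f) t)// mulrA.
Unshelve. all: by end_near. Qed.

Let L1_scale1 : left_id 1 L1_scale.
Proof.
move=> f; apply/L1_eqP; near=> t => _.
by rewrite (near (scaleE 1 f) t)// mul1r.
Unshelve. all: by end_near. Qed.

Let L1_scaleDr : right_distributive L1_scale +%R.
Proof.
move=> a f g; apply/L1_eqP; near=> t => _.
rewrite (near (scaleE a (f + g)) t)// (near (addE f g) t)//.
rewrite (near (addE (L1_scale a f) (L1_scale a g)) t)//.
by rewrite (near (scaleE a f) t)// (near (scaleE a g) t)// mulrDr.
Unshelve. all: by end_near. Qed.

Let L1_scaleDl f : {morph L1_scale^~ f : a b / a + b}.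
Proof.
move=> a b; apply/L1_eqP; near=> t => _.
rewrite (near (scaleE (a + b) f) t)//.
rewrite (near (addE (L1_scale a f) (L1_scale b f)) t)//.
by rewrite (near (scaleE a f) t)// (near (scaleE b f) t)// mulrDl.
Unshelve. all: by end_near. Qed.

HB.instance Definition _ := GRing.Zmodule_isLmodule.Build R L1
  L1_scaleA L1_scale1 L1_scaleDr L1_scaleDl.

Lemma L1_addE (f g : L1) : L1_fun (f + g) = L1_fun f \+ L1_fun g %[ae mu].
Proof. exact: addE. Qed.

Lemma L1_scaleE (a : R) (f : L1) :
  L1_fun (a *: f) = (fun t => a * L1_fun f t) %[ae mu].
Proof. exact: scaleE. Qed.

End L1_space.

(** ** Banach-space isomorphisms

Norms are explicit functions here, since the matrix space below carries a norm
other than the canonical one. *)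

Section isomorphism.
Context (R : realType) (V W : lmodType R).

(** The norm of an operator defined on a subspace [A] of [V]. *)
Definition opnorm (NV : V -> R) (NW : W -> R) (A : set V) (I : V -> W) : \bar R :=
  ereal_sup [set (NW (I v))%:E | v in [set v | A v /\ NV v <= 1]].
End isomorphism.

Definition is_subspace (R : realType) (W : lmodType R) (Y : set W) : Prop :=
  Y 0 /\ forall (a : R) (u v : W), Y u -> Y v -> Y (a *: u + v).

(** [(V, NV)] is [C]-isomorphic to [(Y, NW)], for [Y] a subspace of [W]; [J] is
the inverse of [I] on [Y]. *)
Definition isomorphic_to (R : realType) (C : R) (V W : lmodType R)
    (NV : V -> R) (NW : W -> R) (Y : set W) : Prop :=
  exists (I : {linear V -> W}) (J : W -> V),
    [/\ range I = Y,
        cancel I J,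
        (opnorm NV NW setT I < +oo)%E,
        (opnorm NW NV Y J < +oo)%E
      & (opnorm NV NW setT I * opnorm NW NV Y J <= C%:E)%E].

Definition isomorphic_to_subspace (R : realType) (C : R) (V W : lmodType R)
    (NV : V -> R) (NW : W -> R) : Prop :=
  exists Y : set W, is_subspace Y /\ isomorphic_to C NV NW Y.

(** The real space L_1[0,1]: Lebesgue measure restricted to [0,1]. *)
Definition lebesgue01 (R : realType) : {measure set (measurableTypeR R) -> \bar R} :=
  mrestr (@lebesgue_measure R) (measurable_itv `[0, 1]).

Definition L1_01 (R : realType) : lmodType R := L1 (lebesgue01 R).

(** ** Orlicz functions and norms

A function on [[0, oo)] is represented by a function on [R] whose values at
negative reals are irrelevant. *)

Section orlicz.
Context {R : realType}.

Definition orlicz_function (M : R -> R) : Prop :=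
  [/\ convex_function (`[0, +oo[%classic : set R) M,
      M 0 = 0
    & forall t, 0 < t -> 0 < M t].

Definition luxemburg_norm (M : R -> R) n (x : 'rV[R]_n) : R :=
  inf [set rho | 0 < rho /\ \sum_(i < n) M (`|x 0 i| / rho) <= 1].

(** The dual function may take the value [+oo]. *)
Definition dual_function (M : R -> R) (x : R) : \bar R :=
  ereal_sup [set (x * t - M t)%:E | t in [set t | 0 <= t]].

Definition dual_inverse (M : R -> R) (t : R) : R :=
  sup [set s | 0 <= s /\ (dual_function M s <= t%:E)%E].

Definition lr_norm (r : R) n (x : 'rV[R]_n) : R :=
  (\sum_(i < n) `|x 0 i| `^ r) `^ r^-1.

Definition mixed_norm (M : R -> R) (r : R) n (a : 'M[R]_n) : R :=
  luxemburg_norm M (\row_j lr_norm r (\row_i a i j)).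

(** The vector [((n / i)^(1/q))_(i = 1, ..., n)]; indices in ['I_n] start at 0. *)
Definition power_vector (q : R) n : 'rV[R]_n :=
  \row_(i < n) (n%:R / i.+1%:R) `^ q^-1.

Definition conjugate_exponent (p : R) : R := fine (hoelder_conjugate p%:E).

(** The quantity to which [M_y^{*-1}(l / n)] is equivalent: in terms of indices
in ['I_n], [i <= l] reads [i < l]. *)
Definition dual_inverse_target (p : R) n (y : 'rV[R]_n) (l : nat) : R :=
  n%:R^-1 * (\sum_(i < n | (i < l)%N) y 0 i) +
  (l%:R / n%:R) `^ (conjugate_exponent p)^-1 *
    (n%:R^-1 * \sum_(i < n | (l <= i)%N) `|y 0 i| `^ p) `^ p^-1.

Definition permutation_average n (x y z : 'rV[R]_n) (a : 'M[R]_n) : R :=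
  ((n`!)%:R ^+ 3)^-1 *
  \sum_(pi : {perm 'I_n}) \sum_(sigma : {perm 'I_n}) \sum_(eta : {perm 'I_n})
    Num.sqrt (\sum_(i < n) \sum_(j < n)
      `|a i j * x 0 (pi i) * y 0 (sigma j) * z 0 (eta j)| ^+ 2).

End orlicz.

(* Main.v *)
From HB Require Import structures.
Require Import Defs.
From mathcomp Require Import all_boot all_order all_algebra all_fingroup.
From mathcomp Require Import all_classical all_reals all_analysis.
From mathcomp Require Import measurable_realfun.
From mathcomp Require Import ring lra.
Import Order.TTheory GRing.Theory Num.Theory.
Local Open Scope ring_scope.
Set Implicit Arguments.
Unset Strict Implicit.
Unset Printing Implicit Defensive.

(** The proof rests on one explicit Orlicz function.  Let psi_p(v) = v^p for
v <= 1, continued for v > 1 by its tangent line at 1 ([linpow p]), and put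
M_y(t) = (1/n) sum_i psi_p(t y_i) ([weight_orlicz]).

The dual.  M_y^{*-1}(u) is the largest s such that s t <= u + M_y(t) for all
t > 0, that is, the infimum of (u + M_y(t)) / t.  Let T be the quantity that
has to be compared with M_y^{*-1}(u) for u = l/n.  Splitting the sum M_y(t) at
index l gives T t <= 2 (u + M_y(t)) for every t > 0
([dual_inverse_target_le]), and t = u / T gives (u + M_y(t)) / t <= (2 + p) T
([dual_inverse_le_target]).

The average.  The permutations are averaged out one at a time, pi first, then
eta, then sigma.  The weights x and z imitate r-stable and p-stable variables:
the mean of |(A_i x_{pi(i)})_i|_2 is comparable to |A|_r.  With
A_i = |(a_ij w_j)_j|_2, w_j = y_{sigma(j)} z_{eta(j)}, and B_j the l_r-norm of
column j, the number |A|_r is at least max_j w_j B_j and, because r <= 2, at most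
|(w_j B_j)_j|_r; both bounds have a mean over eta comparable to
|(y_{sigma(j)} B_j)_j|_p because p < r.  Finally the mean over sigma of the
latter is comparable to the Luxemburg norm of B for M_y.

Each of these means is estimated in the same way.  From above,
|v|_s <= 1 + sum_j psi_s(v_j) ([lnorm_le_linpow]), and the mean of the right
side involves only the marginals of a uniform permutation, which are uniform.
From below, a multiple of the norm dominates
kappa sum_i f_i - kappa^2 sum_{i <> j} f_i g_j for a free parameter kappa, and
the double sum is harmless because two distinct coordinates of a uniform
permutation are independent up to a factor 2; this second moment argument is
[mean_perm_quadratic_ge].

The embedding.  By Khintchine's inequality the average is comparable to the
mean of |sum_ij eps_ij a_ij x_{pi(i)} y_{sigma(j)} z_{eta(j)}| over signs and
permutations, which is the L_1-norm of a linear image of the matrix on a finite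
uniform probability space, and such a space is realised in [0,1] by step
functions ([isomorphic_to_subspace_L1]). *)

(** * Norms and linearly continued powers *)

Section lnorm.
Context {R : realType} {I : finType}.
Implicit Types (v w : I -> R) (s t c : R).

(** The norm [lr_norm] on an arbitrary finite index set,
without the detour through row vectors. *)
Definition lnorm s v : R := (\sum_i `|v i| `^ s) `^ s^-1.

Lemma lnorm_ge0 s v : 0 <= lnorm s v.
Proof. exact: powR_ge0. Qed.

Lemma powR_sum_ge0 s v : 0 <= \sum_i `|v i| `^ s.
Proof. by apply: sumr_ge0 => i _; exact: powR_ge0. Qed.

Lemma powR_lnorm s v : 0 < s -> lnorm s v `^ s = \sum_i `|v i| `^ s.
Proof.
by move=> s0; rewrite -powRrM mulVf ?gt_eqF// powRr1// powR_sum_ge0.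
Qed.

Lemma lnorm_leP s v c : 0 < s -> 0 <= c ->
  (lnorm s v <= c) = (\sum_i `|v i| `^ s <= c `^ s).
Proof.
move=> s0 c0; rewrite -powR_lnorm//; apply/idP/idP.
  by move=> h; apply: ge0_ler_powR; rewrite ?nnegrE ?lnorm_ge0 ?(ltW s0).
by apply: contraLR; rewrite -!ltNge => h; apply: gt0_ltr_powR; rewrite ?nnegrE ?lnorm_ge0.
Qed.

Lemma lnormZ s c v : 0 < s -> lnorm s (fun i => c * v i) = `|c| * lnorm s v.
Proof.
move=> s0; rewrite /lnorm.
under eq_bigr do rewrite normrM powRM//.
rewrite -mulr_sumr powRM ?powR_ge0 ?powR_sum_ge0//.
by rewrite -powRrM mulfV ?gt_eqF// powRr1.
Qed.

Lemma le_lnorm s v w : 0 < s -> (forall i, `|v i| <= `|w i|) ->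
  lnorm s v <= lnorm s w.
Proof.
move=> s0 vw; rewrite lnorm_leP ?lnorm_ge0// powR_lnorm//.
by apply: ler_sum => i _; apply: ge0_ler_powR; rewrite ?nnegrE ?(ltW s0).
Qed.

Lemma eq_lnorm s v w : (forall i, `|v i| = `|w i|) -> lnorm s v = lnorm s w.
Proof. by move=> vw; rewrite /lnorm; under eq_bigr do rewrite vw. Qed.

Lemma norm_le_lnorm s v i : 0 < s -> `|v i| <= lnorm s v.
Proof.
move=> s0; rewrite leNgt; apply/negP => h.
have : lnorm s v `^ s < `|v i| `^ s by apply: gt0_ltr_powR; rewrite ?nnegrE ?lnorm_ge0.
rewrite powR_lnorm// (bigD1 i)//= ltNge lerDl sumr_ge0// => j _; exact: powR_ge0.
Qed.

(** Factor |v_i|^t = |v_i|^s |v_i|^(t-s) and bound the last factor by the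
[s]-norm. *)
Lemma lnorm_anti s t v : 0 < s -> s <= t -> lnorm t v <= lnorm s v.
Proof.
move=> s0 st; have t0 := lt_le_trans s0 st.
have L0 := lnorm_ge0 s v.
rewrite lnorm_leP//.
have -> : lnorm s v `^ t = lnorm s v `^ s * lnorm s v `^ (t - s).
  by rewrite -powRD ?subrKC// (gt_eqF t0).
rewrite powR_lnorm// mulr_suml; apply: ler_sum => i _.
have -> : `|v i| `^ t = `|v i| `^ s * `|v i| `^ (t - s).
  by rewrite -powRD ?subrKC// (gt_eqF t0).
rewrite ler_wpM2l ?powR_ge0//.
by apply: ge0_ler_powR; rewrite ?nnegrE ?subr_ge0 ?norm_le_lnorm.
Qed.

End lnorm.

Section linpow.
Context {R : realType}.
Implicit Types s t c v : R.

Lemma powR_le1 c t : 0 <= c -> c <= 1 -> 0 <= t -> c `^ t <= 1.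
Proof.
move=> c0 c1 t0; have : c `^ t <= 1 `^ t by apply: ge0_ler_powR; rewrite ?nnegrE.
by rewrite powR1.
Qed.

Lemma powR_ge1 c t : 1 <= c -> 0 <= t -> 1 <= c `^ t.
Proof. by move=> c1 t0; have := ler_powR c1 t0; rewrite powRr0. Qed.

(** Below 1 it measures the [s]-th power that builds the l_s-norm, above 1 it
grows linearly like a single large coordinate; unlike the minimum of v^s and v
it is convex. *)
Definition linpow s v : R := if v <= 1 then v `^ s else 1 + s * (v - 1).

(** Convexity of v^s in the form of Young's inequality for v and c^(s-1). *)
Lemma young_tangent s v c : 1 < s -> 0 <= v -> 0 <= c ->
  s * c `^ (s - 1) * v - (s - 1) * c `^ s <= v `^ s.
Proof.
move=> s1 v0 c0; have s0 : 0 < s by lra.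
have q0 : 0 < s / (s - 1) by rewrite divr_gt0// subr_gt0.
have := @conjugate_powR _ v (c `^ (s - 1)) s (s / (s - 1)) v0 (powR_ge0 _ _) s0 q0.
rewrite -powRrM mulrCA mulfV ?mulr1 ?subr_eq0 ?gt_eqF//.
have -> : s^-1 + (s / (s - 1))^-1 = 1 by rewrite invf_div; field; rewrite gt_eqF.
move=> /(_ erefl) h.
have : s * (v * c `^ (s - 1)) <= s * (v `^ s / s + c `^ s / (s / (s - 1))).
  by rewrite ler_pM2l.
have -> : s * (v `^ s / s + c `^ s / (s / (s - 1))) = v `^ s + (s - 1) * c `^ s.
  by rewrite invf_div; field; rewrite gt_eqF.
lra.
Qed.

(** With [linpow_support], this makes [linpow s] a supremum of affine functions;
convexity and superhomogeneity are read off from that. *)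
Lemma linpow_tangent s v c : 1 < s -> 0 <= v -> 0 <= c <= 1 ->
  s * c `^ (s - 1) * v - (s - 1) * c `^ s <= linpow s v.
Proof.
move=> s1 v0 /andP[c0 c1]; rewrite /linpow; case: ifPn => [_|].
  exact: young_tangent.
rewrite -ltNge => v1.
have := @young_tangent s 1 c s1 ler01 c0; rewrite powR1.
have : c `^ (s - 1) <= 1 by apply: powR_le1 => //; lra.
have := powR_ge0 c (s - 1); set d := c `^ (s - 1) => d0 d1.
have : 0 <= s * (1 - d) * (v - 1) by rewrite !mulr_ge0 ?subr_ge0 ?(ltW v1)//; lra.
lra.
Qed.

Lemma linpow_support s v : 1 < s -> 0 <= v ->
  exists2 c, 0 <= c <= 1 & linpow s v = s * c `^ (s - 1) * v - (s - 1) * c `^ s.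
Proof.
move=> s1 v0; rewrite /linpow; case: ifPn => v1.
  exists v; first by rewrite v0.
  by rewrite -mulrA [_ * v]mulrC mulr_powRB1 ?(lt_trans ltr01)//; lra.
by exists 1; rewrite ?ler01 ?lexx// !powR1; lra.
Qed.

Lemma linpow_ge0 s v : 1 < s -> 0 <= v -> 0 <= linpow s v.
Proof.
move=> s1 v0; rewrite /linpow; case: ifPn => [_|]; first exact: powR_ge0.
by rewrite -ltNge => v1; nra.
Qed.

Lemma linpow_gt0 s v : 1 < s -> 0 < v -> 0 < linpow s v.
Proof.
move=> s1 v0; rewrite /linpow; case: ifPn => [_|]; first exact: powR_gt0.
by rewrite -ltNge => v1; nra.
Qed.

Lemma linpow0 s : 1 < s -> linpow s 0 = 0.
Proof. by move=> s1; rewrite /linpow ler01 powR0// gt_eqF// (lt_trans ltr01). Qed.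

Lemma linpow_convex s u v l : 1 < s -> 0 <= u -> 0 <= v -> 0 <= l <= 1 ->
  linpow s (l * u + (1 - l) * v) <= l * linpow s u + (1 - l) * linpow s v.
Proof.
move=> s1 u0 v0 /andP[l0 l1].
have w0 : 0 <= l * u + (1 - l) * v by rewrite addr_ge0 ?mulr_ge0 ?subr_ge0.
have [c c01 ->] := @linpow_support s _ s1 w0.
have /(ler_wpM2l l0) hu := @linpow_tangent s u c s1 u0 c01.
have l1' : 0 <= 1 - l by lra.
have /(ler_wpM2l l1') hv := @linpow_tangent s v c s1 v0 c01.
lra.
Qed.

(** The supporting lines have a nonpositive value at 0, so stretching the
argument by [t >= 1] gains at least the factor [t]. *)
Lemma linpow_superhomogeneous s t v : 1 < s -> 1 <= t -> 0 <= v ->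
  t * linpow s v <= linpow s (t * v).
Proof.
move=> s1 t1 v0.
have [c c01 ->] := @linpow_support s v s1 v0.
have tv0 : 0 <= t * v by nra.
apply: le_trans (@linpow_tangent s _ c s1 tv0 c01).
have := powR_ge0 c s; set d := c `^ s => d0.
have : 0 <= (t - 1) * ((s - 1) * d) by rewrite !mulr_ge0//; lra.
lra.
Qed.

Lemma linpow_le_powR s v : 1 < s -> 0 <= v -> linpow s v <= v `^ s.
Proof.
move=> s1 v0; rewrite /linpow; case: ifPn => // _.
by have := @young_tangent s v 1 s1 v0 ler01; rewrite !powR1; lra.
Qed.

Lemma linpow_le_linear s v : 1 < s -> 0 <= v -> linpow s v <= s * v.
Proof.
move=> s1 v0; rewrite /linpow; case: ifPn => [v1|_]; last lra.
move: v0; rewrite le_eqVlt => /predU1P[<-|v0].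
  by rewrite powR0 ?mulr0// gt_eqF// (lt_trans ltr01).
by have := @ge1r_powR _ v s; rewrite v0 v1 => /(_ isT (ltW s1)); nra.
Qed.

Lemma linear_le_linpow s v : 1 < s -> 0 <= v -> v <= 1 + linpow s v.
Proof.
move=> s1 v0; rewrite /linpow; case: ifPn => [v1|]; last by rewrite -ltNge; nra.
by have := powR_ge0 v s; lra.
Qed.

(** How much the linear continuation loses: on [0, c] it is smaller than the
power by at most the factor c^(s-1). *)
Lemma powR_le_linpow s v c : 1 < s -> 0 <= v -> v <= c -> 1 <= c ->
  v `^ s <= linpow s v * c `^ (s - 1).
Proof.
move=> s1 v0 vc c1; have s0 : 0 < s by lra.
rewrite /linpow; case: ifPn => [v1|].
  rewrite ler_peMr ?powR_ge0// powR_ge1//; lra.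
rewrite -ltNge => v1; rewrite -mulr_powRB1//.
have h : v `^ (s - 1) <= c `^ (s - 1) by apply: ge0_ler_powR; rewrite ?nnegrE; lra.
apply: ler_pM => //; rewrite ?powR_ge0//; nra.
Qed.

End linpow.

Section sum_linpow.
Context {R : realType} {I : finType}.
Implicit Types (s : R) (v : I -> R).

(** If L = |v|_s > 1, then v / L has all coordinates below 1 and
sum_i psi(v_i / L) = 1; superhomogeneity multiplies this by L. *)
Lemma lnorm_le_linpow s v : 1 < s -> (forall i, 0 <= v i) ->
  lnorm s v <= 1 + \sum_i linpow s (v i).
Proof.
move=> s1 v0; have s0 : 0 < s by lra.
have S0 : 0 <= \sum_i linpow s (v i) by apply: sumr_ge0 => i _; exact: linpow_ge0.
have [|L1] := leP (lnorm s v) 1; first lra.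
suff : lnorm s v <= \sum_i linpow s (v i) by lra.
set L := lnorm s v in L1 *.
have L0 : 0 < L by lra.
have e : \sum_i (v i / L) `^ s = 1.
  rewrite (_ : 1 = L `^ s / L `^ s); last by rewrite mulfV// gt_eqF// powR_gt0.
  rewrite {1}powR_lnorm// mulr_suml; apply: eq_bigr => i _.
  rewrite (ger0_norm (v0 i)) powRM ?invr_ge0 ?(ltW L0)//.
  by rewrite -powR_inv1 ?(ltW L0)// powRAC powR_inv1// powR_ge0.
rewrite -[leLHS]mulr1 -[X in _ * X <= _]e mulr_sumr; apply: ler_sum => i _.
have vL : 0 <= v i / L by rewrite divr_ge0// ltW.
have -> : (v i / L) `^ s = linpow s (v i / L).
  rewrite /linpow ifT// ler_pdivrMr// mul1r -[v i]ger0_norm//.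
  exact: norm_le_lnorm.
apply: le_trans (@linpow_superhomogeneous _ s L _ s1 (ltW L1) vL) _.
by rewrite mulrC mulfVK// gt_eqF.
Qed.

End sum_linpow.

(** * Means over finite sets and over permutations *)

Section finite_mean.
Context {R : realType}.

Section one_space.
Context {Omega : finType}.
Implicit Types F G : Omega -> R.

Definition mean F : R := #|Omega|%:R^-1 * \sum_w F w.

Lemma le_mean F G : (forall w, F w <= G w) -> mean F <= mean G.
Proof.
by move=> FG; rewrite /mean ler_wpM2l ?invr_ge0//; apply: ler_sum.
Qed.

Lemma mean_ge0 F : (forall w, 0 <= F w) -> 0 <= mean F.
Proof. by move=> F0; rewrite /mean mulr_ge0 ?invr_ge0 ?sumr_ge0. Qed.

Lemma meanZ c F : mean (fun w => c * F w) = c * mean F.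
Proof. by rewrite /mean -mulr_sumr mulrCA. Qed.

Lemma meanD F G : mean (fun w => F w + G w) = mean F + mean G.
Proof. by rewrite /mean big_split mulrDr. Qed.

Lemma mean_sum (J : finType) (P : pred J) (F : J -> Omega -> R) :
  mean (fun w => \sum_(j | P j) F j w) = \sum_(j | P j) mean (F j).
Proof. by rewrite /mean exchange_big/= mulr_sumr. Qed.

Lemma mean_cst c : (0 < #|Omega|)%N -> mean (fun=> c) = c.
Proof.
move=> Omega0; rewrite /mean sumr_const -[c *+ _]mulr_natl mulKf//.
by rewrite pnatr_eq0 -lt0n.
Qed.

End one_space.

Lemma mean_prod (A B : finType) (G : A * B -> R) :
  mean G = mean (fun s => mean (fun w => G (s, w))).
Proof.
rewrite /mean card_prod natrM invfM -mulrA; congr (_ * _).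
have -> : \sum_w G w = \sum_s \sum_w G (s, w).
  by rewrite pair_bigA; apply: eq_bigr => -[].
by rewrite mulr_sumr.
Qed.

End finite_mean.

Section mean_perm.
Context {R : realType} {n : nat}.
Implicit Types (f g : 'I_n -> R) (i j k : 'I_n).

Lemma card_perm_ord : #|{perm 'I_n}| = n`!.
Proof. by rewrite -[LHS]cardsT -card_Sn; apply: eq_card => s; rewrite !inE. Qed.

Lemma mean_perm_cst (c : R) : mean (fun _ : {perm 'I_n} => c) = c.
Proof. by rewrite mean_cst// card_perm_ord fact_gt0. Qed.

(** Composing with a transposition shows that the mean is independent of [i], and
the sum over [i] of f (s i) does not depend on the permutation. *)
Lemma mean_perm_eval f i : mean (fun s : {perm 'I_n} => f (s i)) = n%:R^-1 * \sum_k f k.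
Proof.
have n0 : n%:R != 0 :> R by rewrite pnatr_eq0 -lt0n (leq_ltn_trans _ (ltn_ord i)).
have c j : mean (fun s : {perm 'I_n} => f (s j)) = mean (fun s : {perm 'I_n} => f (s i)).
  rewrite /mean; congr (_ * _).
  rewrite (reindex_inj (mulgI (tperm i j)))/=.
  by apply: eq_bigr => s _; rewrite permM tpermR.
apply: (mulfI n0); rewrite mulVKf//.
have -> : n%:R * mean (fun s : {perm 'I_n} => f (s i)) =
    \sum_j mean (fun s : {perm 'I_n} => f (s j)).
  by rewrite (eq_bigr _ (fun j _ => c j)) sumr_const card_ord mulr_natl.
rewrite -mean_sum -[RHS]mean_perm_cst.
congr mean; apply/funext => s.
by rewrite [RHS](reindex_inj (@perm_inj _ s)).
Qed.

(** Given s i, the value s j is uniform on the n - 1 remaining points, whence the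
bound with n / (n - 1) <= 2 in front. *)
Lemma mean_perm_pair f g i j : i != j -> (forall k, 0 <= f k) ->
    (forall k, 0 <= g k) ->
  mean (fun s : {perm 'I_n} => f (s i) * g (s j)) <=
    2 * ((n%:R^-1 * \sum_k f k) * (n%:R^-1 * \sum_k g k)).
Proof.
move=> ij f0 g0.
have n1 : (1 < n)%N.
  rewrite ltnNge; apply: contra ij => n1; apply/eqP/val_inj => /=.
  by move: (ltn_ord i) (ltn_ord j); case: n n1 (val i) (val j) => [|[|//]] _ [|?] [|?].
have n0 : 0 < n%:R - 1 :> R by rewrite subr_gt0 ltr1n.
have c k : k != i ->
    mean (fun s : {perm 'I_n} => f (s i) * g (s k)) =
      mean (fun s : {perm 'I_n} => f (s i) * g (s j)).
  move=> ki; rewrite /mean; congr (_ * _).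
  rewrite (reindex_inj (mulgI (tperm j k)))/=.
  by apply: eq_bigr => s _; rewrite !permM tpermR tpermD// eq_sym.
have : (n%:R - 1) * mean (fun s : {perm 'I_n} => f (s i) * g (s j)) <=
    (n%:R^-1 * \sum_k f k) * \sum_k g k.
  rewrite -(mean_perm_eval f i) [leRHS]mulrC -[leRHS]meanZ.
  have -> : n%:R - 1 = #|predC1 i|%:R :> R.
    have : (#|pred1 i| + #|predC1 i|)%N = n by rewrite cardC card_ord.
    by rewrite card1 => nE; rewrite -[in LHS]nE natrD addrAC subrr add0r.
  rewrite mulr_natl -sumr_const -(eq_bigr _ c).
  rewrite -mean_sum.
  apply: le_mean => s; rewrite -mulr_sumr mulrC ler_wpM2r//.
  rewrite [leRHS](reindex_inj (@perm_inj _ s))/= [leRHS](bigD1 i)//=.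
  by rewrite lerDr.
have F0 : 0 <= \sum_k f k by exact: sumr_ge0.
have G0 : 0 <= \sum_k g k by exact: sumr_ge0.
have nr : 2 <= n%:R :> R by rewrite ler_nat.
rewrite -ler_pdivlMl// => /le_trans; apply.
have h : (n%:R - 1)^-1 <= 2 * n%:R^-1 :> R.
  rewrite -[2]invrK -invfM lef_pV2 ?posrE//; first lra.
  by rewrite mulr_gt0 ?invr_gt0//; lra.
rewrite [leRHS](_ : _ =
  2 * n%:R^-1 * (n%:R^-1 * (\sum_k f k) * \sum_k g k)); last by ring.
by rewrite ler_wpM2r// !mulr_ge0// invr_ge0.
Qed.

End mean_perm.

(** * Lower bounds for means over permutations *)

Section mean_perm_lower.
Context {R : realType} {n : nat}.
Implicit Types (f g : 'I_n -> 'I_n -> R) (rho : {perm 'I_n} -> R).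

(** A second moment argument with the parameter [kappa] left free.  Let m and G be
the means of sum_i f_i (s i) and sum_i g_i (s i).  Near-independence bounds the
mean of the hypothesis from below by kappa m - 2 kappa^2 m G, which is at least
kappa m / 2 as soon as kappa G <= 1/4.  Two functions are needed because [f] may
be unbounded where only a bounded [g] is allowed to compete with it. *)
Lemma mean_perm_quadratic_ge f g rho (theta : R) :
    (forall i k, 0 <= g i k) -> (forall i k, g i k <= f i k) ->
    0 < theta <= 1 -> theta <= n%:R^-1 * \sum_i \sum_k f i k ->
    (forall (s : {perm 'I_n}) (kappa : R), 0 < kappa <= 1 ->
      kappa * (\sum_i f i (s i)) -
        kappa ^+ 2 * (\sum_i \sum_(j | j != i) f i (s i) * g j (s j)) <= rho s) ->
  theta / 8 <= mean rho.
Proof.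
move=> g0 gf /andP[t0 t1] tm hrho.
have f0 i k : 0 <= f i k by exact: le_trans (g0 i k) (gf i k).
set m := n%:R^-1 * _ in tm.
pose G : R := n%:R^-1 * \sum_i \sum_k g i k.
have n0 : 0 <= n%:R^-1 :> R by rewrite invr_ge0.
have G0 : 0 <= G.
  by rewrite mulr_ge0//; apply: sumr_ge0 => i _; exact: sumr_ge0.
have Gm : G <= m.
  by rewrite ler_wpM2l//; apply: ler_sum => i _; exact: ler_sum.
suff key (kappa : R) : 0 < kappa <= 1 ->
    kappa * m - 2 * kappa ^+ 2 * (m * G) <= mean rho.
  (* kappa = min 1 (1 / (4 G)); in the second case m >= G gives the bound 1/8 *)
  have [G4|G4] := leP G 4^-1.
    by have := key 1; rewrite ltr01 lexx => /(_ isT); nra.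
  have k1 : 0 < (4 * G)^-1 <= 1.
    by rewrite invr_gt0 invf_le1; lra.
  have := key _ k1.
  have -> : (4 * G)^-1 * m - 2 * (4 * G)^-1 ^+ 2 * (m * G) = (m / G) / 8.
    by field; lra.
  have : 1 <= m / G by rewrite ler_pdivlMr ?mul1r//; lra.
  lra.
move=> k01; have /andP[k0 _] := k01.
apply: le_trans (le_mean (fun s : {perm 'I_n} => hrho s kappa k01)).
under eq_fun do rewrite -mulNr.
rewrite meanD !meanZ mulNr.
have -> : mean (fun s : {perm 'I_n} => \sum_i f i (s i)) = m.
  rewrite mean_sum /m mulr_sumr; apply: eq_bigr => i _.
  exact: mean_perm_eval.
rewrite lerD2l lerN2 [leRHS](_ : _ = kappa ^+ 2 * (m * G * 2)); last by ring.
rewrite ler_wpM2l ?sqr_ge0//.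
have -> : m * G * 2 =
    \sum_i \sum_j 2 * ((n%:R^-1 * \sum_k f i k) * (n%:R^-1 * \sum_k g j k)).
  rewrite /m mulr_sumr !mulr_suml; apply: eq_bigr => i _.
  by rewrite -!mulr_sumr -/G mulrC.
rewrite mean_sum; apply: ler_sum => i _.
rewrite mean_sum [leRHS](bigID (fun j => j != i))/=.
rewrite -[leLHS]addr0 lerD//; last first.
  by apply: sumr_ge0 => j _; rewrite !mulr_ge0// sumr_ge0.
by apply: ler_sum => j ji; apply: mean_perm_pair; rewrite 1?eq_sym.
Qed.

(** [f i] is the set of values of s i that make [rho] large.  If N of these events
occur, the quadratic expression is kappa N (1 + kappa - kappa N), which never
exceeds 1 for kappa <= 1. *)
Lemma mean_perm_max_ge (f : 'I_n -> {set 'I_n}) rho :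
    (forall s, 0 <= rho s) -> (forall (s : {perm 'I_n}) i, s i \in f i -> 1 <= rho s) ->
    2^-1 <= n%:R^-1 * (\sum_i #|f i|)%:R :> R ->
  16^-1 <= mean rho.
Proof.
move=> rho0 rho1 h.
pose g i k : R := (k \in f i)%:R.
have -> : 16^-1 = 2^-1 / 8 :> R by field.
apply: (@mean_perm_quadratic_ge g g).
- by move=> i k; rewrite ler0n.
- by [].
- lra.
- rewrite (le_trans h)// ler_wpM2l ?invr_ge0// natr_sum ler_sum// => i _.
  rewrite -sum1_card natr_sum big_mkcond/=.
  by apply: ler_sum => k _; rewrite /g; case: ifP.
move=> s kappa /andP[k0 k1].
pose N : R := \sum_i g i (s i).
have -> : \sum_i \sum_(j | j != i) g i (s i) * g j (s j) = N * (N - 1).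
  rewrite mulr_suml; apply: eq_bigr => i _.
  rewrite -mulr_sumr /N [in RHS](bigD1 i)//= mulrBr mulr1 mulrDr.
  have -> : g i (s i) * g i (s i) = g i (s i).
    by rewrite /g; case: (_ \in _); rewrite ?mulr1 ?mulr0.
  by lra.
rewrite -/N.
have [[i si]|none] := pselect (exists i, s i \in f i); last first.
  have -> : N = 0.
    apply: big1 => i _; rewrite /g; apply/eqP; rewrite pnatr_eq0 eqb0.
    by apply/negP => si; case: none; exists i.
  by rewrite mulr0 mul0r mulr0 subrr.
apply: le_trans (rho1 _ _ si).
have := sqr_ge0 (kappa * N - (1 + kappa) / 2); nra.
Qed.

End mean_perm_lower.

Section lnorm_quadratic.
Context {R : realType} {I : finType}.

(** Write L = |v|_s, U = sum_j min(v_j^s, 1) and S = sum_i psi_s(v_i).  If L < 1,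
then S = U = L^s <= L.  If L >= 1, then S <= s L U because psi_s(v) is at most
s L min(v^s, 1), and kappa U (1 + kappa - kappa U) <= 1. *)
Lemma lnorm_quadratic_ge (s kappa : R) (v : I -> R) :
    1 < s -> 0 < kappa <= 1 -> (forall i, 0 <= v i) ->
  kappa * (\sum_i linpow s (v i)) -
    kappa ^+ 2 * (\sum_i \sum_(j | j != i) linpow s (v i) * Num.min (v j `^ s) 1) <=
  s * lnorm s v.
Proof.
move=> s1 /andP[k0 k1] v0; have s0 : 0 < s by lra.
set u := fun j => Num.min (v j `^ s) 1.
pose U := \sum_j u j.
have u0 j : 0 <= u j by rewrite /u le_min powR_ge0 ler01.
have u1 j : u j <= 1 by rewrite /u ge_min lexx orbT.
have p0 j : 0 <= linpow s (v j) by exact: linpow_ge0.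
have U0 : 0 <= U by exact: sumr_ge0.
have uU j : u j <= U by rewrite /U (bigD1 j)//= lerDl sumr_ge0.
have -> : \sum_i \sum_(j | j != i) linpow s (v i) * u j =
    \sum_i linpow s (v i) * (U - u i).
  by apply: eq_bigr => i _; rewrite -mulr_sumr /U [in RHS](bigD1 i)//= addrAC subrr add0r.
have L0 := lnorm_ge0 s v; set L := lnorm s v in L0 *.
have [L1|L1] := ltP L 1.
  have v1 i : v i <= 1.
    by apply: le_trans (ltW L1); rewrite -[v i]ger0_norm// norm_le_lnorm.
  have pu i : linpow s (v i) = u i.
    rewrite /linpow v1 /u min_l// powR_le1// ltW//.
  have UL : U <= L.
    have -> : U = L `^ s.
      rewrite /L powR_lnorm//; apply: eq_bigr => i _.
      by rewrite -pu /linpow v1 ger0_norm.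
    have [->|L00] := eqVneq L 0; first by rewrite powR0// gt_eqF.
    by apply: ge1r_powR; rewrite ?(ltW s1)// (ltW L1) lt_neqAle eq_sym L00 L0.
  have : \sum_i linpow s (v i) = U by apply: eq_bigr.
  move=> ->.
  have : 0 <= \sum_i linpow s (v i) * (U - u i).
    by apply: sumr_ge0 => i _; rewrite mulr_ge0// subr_ge0.
  nra.
pose S := \sum_i linpow s (v i).
have SU : S <= s * L * U.
  rewrite /S /U mulr_sumr; apply: ler_sum => i _.
  rewrite /u; have [vi|vi] := leP (v i) 1.
    have := powR_le1 (v0 i) vi (ltW s0) => h.
    rewrite min_l// (le_trans (linpow_le_powR s1 (v0 i)))//.
    by rewrite ler_peMl ?powR_ge0//; nra.
  have h : 1 <= v i `^ s by rewrite powR_ge1// ltW.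
  rewrite min_r// mulr1 (le_trans (linpow_le_linear s1 (v0 i)))// ler_pM2l//.
  by rewrite -[v i]ger0_norm// norm_le_lnorm.
have h : S * (U - 1) <= \sum_i linpow s (v i) * (U - u i).
  by rewrite /S mulr_suml; apply: ler_sum => i _; rewrite ler_wpM2l// lerB.
have S0 : 0 <= S by exact: sumr_ge0.
have k20 : 0 < kappa ^+ 2 by rewrite exprn_gt0.
apply: (@le_trans _ _ (kappa * S * (1 + kappa - kappa * U))).
  have : kappa ^+ 2 * (S * (U - 1)) <= kappa ^+ 2 * \sum_i linpow s (v i) * (U - u i).
    by rewrite ler_pM2l.
  rewrite -/S; nra.
have sL : 0 <= s * L by nra.
have [neg|pos] := leP (1 + kappa - kappa * U) 0.
  by apply: le_trans sL; rewrite mulr_ge0_le0// mulr_ge0// ltW.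
apply: (@le_trans _ _ (kappa * (s * L * U) * (1 + kappa - kappa * U))).
  by rewrite ler_pM2r// ler_pM2l.
have : 0 <= s * L * (kappa * U - (1 + kappa) / 2) ^+ 2 by rewrite mulr_ge0 ?sqr_ge0.
have : s * L * ((1 + kappa) / 2) ^+ 2 <= s * L * 1.
  rewrite ler_wpM2l//; nra.
rewrite mulr1; lra.
Qed.

End lnorm_quadratic.

(** * Power weights *)

Section power_sums.
Context {R : realType}.
Implicit Types (x t g d : R).

Lemma powR_div x y t : 0 <= x -> 0 <= y -> (x / y) `^ t = x `^ t * y `^ (- t).
Proof.
by move=> x0 y0; rewrite powRM ?invr_ge0// -(powR_inv1 y0) -powRrM mulN1r.
Qed.

(** [young_tangent] for the exponent 1/g and the number x^g. *)
Lemma powR_le_tangent x g : 0 < g < 1 -> 0 <= x -> x `^ g <= 1 + g * (x - 1).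
Proof.
move=> /andP[g0 g1] x0.
have s1 : 1 < g^-1 by rewrite invf_gt1.
have := @young_tangent _ _ (x `^ g) 1 s1 (powR_ge0 _ _) ler01.
rewrite !powR1 -powRrM mulfV ?gt_eqF// powRr1// !mulr1 => h.
have : g * (g^-1 * x `^ g - (g^-1 - 1)) <= g * x by rewrite ler_pM2l.
rewrite mulrBr mulrA mulrBr mulfV ?gt_eqF//; lra.
Qed.

Lemma powRN_ge_tangent x d : 0 < d -> 0 < x -> 1 + d * (1 - x) <= x `^ (- d).
Proof.
move=> d0 x0; rewrite /powR gt_eqF//.
apply: le_trans (expR_ge1Dx _); rewrite lerD2l mulNr -mulrN ler_pM2l//.
have -> : x = 1 + (x - 1) by lra.
by have := @le_ln1Dx _ (x - 1); move=> /(_ _); lra.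
Qed.

(** Each term is at most the increment of k^g / g between k and k + 1. *)
Lemma sum_powR_le g K : 0 < g < 1 ->
  \sum_(0 <= k < K) (k.+1%:R : R) `^ (g - 1) <= K%:R `^ g / g.
Proof.
move=> g01; have /andP[g0 g1] := g01.
elim: K => [|K IH]; first by rewrite big_nil divr_ge0// ?powR_ge0// ltW.
rewrite big_nat_recr//=; apply: le_trans (lerD IH (lexx _)) _.
rewrite ler_pdivlMr// mulrDl mulfVK ?gt_eqF//.
have K0 : 0 < K.+1%:R :> R by rewrite ltr0n.
have := @powR_le_tangent (K%:R / K.+1%:R) g g01; rewrite divr_ge0// => /(_ isT).
rewrite powR_div// powRN => h.
have p0 := powR_gt0 g K0.
rewrite powRB ?(gt_eqF K0) ?implybT// powRr1 ?ler0n//.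
rewrite [leRHS](_ : _ = K.+1%:R `^ g * (1 + g * (K%:R / K.+1%:R - 1)) +
    K.+1%:R `^ g / K.+1%:R * g); last first.
  by rewrite -natr1; field; rewrite natr1 gt_eqF.
by rewrite lerD2r -ler_pdivrMl// mulrC.
Qed.

(** Each term is at most the decrease of k^(-d) / d between k and k + 1; the right
side is kept in telescoped form for the induction. *)
Lemma sum_powR_tail_le d K m : 0 < d -> (0 < K)%N ->
  \sum_(K <= k < K + m) (k.+1%:R : R) `^ (- (1 + d)) <=
    (K%:R `^ (- d) - (K + m)%:R `^ (- d)) / d.
Proof.
move=> d0 K0; elim: m => [|m IH].
  by rewrite addn0 big_geq// subrr mul0r.
rewrite addnS big_nat_recr ?leq_addr//=; apply: le_trans (lerD IH (lexx _)) _.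
rewrite ler_pdivlMr// mulrDl mulfVK ?gt_eqF//.
have k0 : 0 < (K + m)%:R :> R by rewrite ltr0n addn_gt0 K0.
have {IH} := k0; move: (K + m)%N => k kr0.
have k1 : 0 < k.+1%:R :> R by rewrite ltr0n.
have := @powRN_ge_tangent (k%:R / k.+1%:R) d d0 (divr_gt0 kr0 k1).
rewrite powR_div// ?(ltW kr0)// opprK => h.
rewrite opprD powRD ?(gt_eqF k1) ?implybT// powR_inv1 ?ler0n//.
have p0 := powR_gt0 (- d) k1.
have : k.+1%:R `^ (- d) * (1 + d * (1 - k%:R / k.+1%:R)) <= k%:R `^ (- d).
  by rewrite -ler_pdivlMl// -powRN opprK [leRHS]mulrC.
have -> : k.+1%:R `^ (- d) * (1 + d * (1 - k%:R / k.+1%:R)) =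
    k.+1%:R `^ (- d) + k.+1%:R^-1 * k.+1%:R `^ (- d) * d.
  by rewrite -natr1; field; rewrite natr1 gt_eqF.
set u := _ * d; move: (k%:R `^ _) (k.+1%:R `^ _) (K%:R `^ _) => *; lra.
Qed.

(** The terms come from the head (linear bound) and the tail (power bound) of the
sum in [sum_linpow_power_le], and from the case T < 1. *)
Definition linpow_sum_const (q s : R) : R :=
  s / (1 - q^-1) + 2 `^ (s / q - 1) / (s / q - 1) + 1 + (s / q - 1)^-1.

Lemma linpow_sum_const_ge0 q s : 1 < q -> q < s -> 0 <= linpow_sum_const q s.
Proof.
move=> q1 qs; have q0 : 0 < q by lra.
have a1 : q^-1 < 1 by rewrite invf_lt1.
have b1 : 1 < s / q by rewrite ltr_pdivlMr ?mul1r.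
by rewrite /linpow_sum_const !addr_ge0 ?divr_ge0 ?invr_ge0 ?powR_ge0//; lra.
Qed.

(** The argument exceeds 1 for about T values of k.  There the linear bound
s (T/k)^(1/q) is summable up to T because 1/q < 1, and beyond them the power
bound (T/k)^(s/q) has a convergent tail because s/q > 1; both contribute a
multiple of T.  If T < 1, only the tail is present. *)
Lemma sum_linpow_power_le q s T n : 1 < q -> q < s -> 0 <= T ->
  \sum_(0 <= k < n) linpow s ((T / k.+1%:R) `^ q^-1) <= linpow_sum_const q s * T.
Proof.
move=> q1 qs T0; have q0 : 0 < q by lra.
have s1 : 1 < s by lra.
have a0 : 0 < q^-1 by rewrite invr_gt0.
have a1 : q^-1 < 1 by rewrite invf_lt1.
have b1 : 1 < s / q by rewrite ltr_pdivlMr ?mul1r.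
rewrite /linpow_sum_const; set d := s / q - 1; have d0 : 0 < d by rewrite /d; lra.
set g := 1 - q^-1; have g01 : 0 < g < 1 by rewrite /g; lra.
have /andP[g0 g1] := g01.
have A0 : 0 <= 2 `^ d / d by rewrite divr_ge0 ?powR_ge0 ?ltW.
have B0 : 0 <= s / g by rewrite divr_ge0 ?ltW//; lra.
have D0 : 0 <= d^-1 by rewrite invr_ge0 ltW.
pose a k := linpow s ((T / k.+1%:R) `^ q^-1).
have age0 k : 0 <= a k by apply: linpow_ge0 => //; exact: powR_ge0.
have alin k : a k <= s * T `^ q^-1 * k.+1%:R `^ (g - 1).
  apply: le_trans (linpow_le_linear s1 (powR_ge0 _ _)) _.
  by rewrite powR_div// mulrA (_ : g - 1 = - q^-1)// /g; lra.
have apow k : a k <= T `^ (1 + d) * k.+1%:R `^ (- (1 + d)).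
  apply: le_trans (linpow_le_powR s1 (powR_ge0 _ _)) _.
  rewrite -powRrM [_^-1 * s]mulrC powR_div//.
  by rewrite (_ : 1 + d = s / q)// /d; lra.
have [T1|T1] := ltP T 1.
  have TT : T `^ (1 + d) <= T.
    move: T0; rewrite le_eqVlt => /predU1P[<-|T0]; first by rewrite powR0// gt_eqF//; lra.
    by apply: ge1r_powR; rewrite ?T0 ?ltW//=; lra.
  have tail : \sum_(1 <= k < 1 + n) (k.+1%:R : R) `^ (- (1 + d)) <= d^-1.
    apply: le_trans (sum_powR_tail_le n d0 (ltn0Sn 0)) _.
    rewrite -[leRHS]mul1r ler_pM2r ?invr_gt0// powR1.
    by have := powR_ge0 (1 + n)%:R (- d); lra.
  have : \sum_(0 <= k < n) a k <= \sum_(0 <= k < 1 + n) a k.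
    by rewrite add1n big_nat_recr//= lerDl.
  move=> /le_trans; apply.
  rewrite big_ltn//; set S := \sum_(1 <= k < 1 + n) a k.
  have : S <= T * d^-1.
    apply: (@le_trans _ _ (T `^ (1 + d) *
        \sum_(1 <= k < 1 + n) (k.+1%:R : R) `^ (- (1 + d)))).
      by rewrite /S mulr_sumr; apply: ler_sum => k _.
    apply: ler_pM => //; rewrite ?powR_ge0// sumr_ge0// => k _; exact: powR_ge0.
  have : a 0%N <= T.
    by apply: le_trans (apow 0%N) _; rewrite powR1 mulr1.
  nra.
(* T / 2 <= K <= T, so K can replace T up to the factor 2^d *)
set K := Num.truncn T.
have /andP[KT TK] : K%:R <= T < K.+1%:R by apply: truncn_itv.
have K0 : (0 < K)%N by rewrite -ltnS -(ltr_nat R); apply: le_lt_trans TK.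
have Kr1 : 1 <= K%:R :> R by rewrite ler1n.
have Tpos : 0 < T by lra.
have : \sum_(0 <= k < n) a k <= \sum_(0 <= k < K + n) a k.
  rewrite (@big_cat_nat _ _ _ n 0 (K + n)) ?leq_addl//= lerDl.
  by apply: sumr_ge0 => k _.
move=> /le_trans; apply.
rewrite (@big_cat_nat _ _ _ K 0 (K + n)) ?leq_addr//=.
have h1 : \sum_(0 <= k < K) a k <= s / g * T.
  apply: (@le_trans _ _ (s * T `^ q^-1 * (K%:R `^ g / g))).
    apply: le_trans (ler_wpM2l _ (sum_powR_le K g01)); last first.
      by rewrite mulr_ge0 ?powR_ge0//; lra.
    by rewrite mulr_sumr; apply: ler_sum => k _.
  have : K%:R `^ g <= T `^ g by apply: ge0_ler_powR; rewrite ?nnegrE ?ler0n// ltW.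
  have -> : s / g * T = s * T `^ q^-1 * (T `^ g / g).
    rewrite -[in LHS](powRr1 T0) (_ : 1 = q^-1 + g); last by rewrite /g; lra.
    rewrite powRD; first by ring.
    by rewrite (gt_eqF Tpos) implybT.
  move=> h; rewrite ler_wpM2l ?mulr_ge0 ?powR_ge0//; first lra.
  by rewrite ler_pM2r// invr_gt0.
have h2 : \sum_(K <= k < K + n) a k <= 2 `^ d / d * T.
  apply: (@le_trans _ _ (T `^ (1 + d) * (K%:R `^ (- d) / d))).
    apply: (@le_trans _ _ (T `^ (1 + d) *
        \sum_(K <= k < K + n) (k.+1%:R : R) `^ (- (1 + d)))).
      by rewrite mulr_sumr; apply: ler_sum => k _.
    rewrite ler_wpM2l ?powR_ge0//; apply: le_trans (sum_powR_tail_le n d0 K0) _.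
    rewrite ler_pM2r ?invr_gt0//.
    by have := powR_ge0 (K + n)%:R (- d); lra.
  rewrite powRD ?(gt_eqF Tpos) ?implybT// powRr1//.
  rewrite (_ : _ * _ = (T / K%:R) `^ d / d * T); last by rewrite powR_div//; ring.
  rewrite ler_pM2r// ler_pM2r ?invr_gt0//.
  apply: ge0_ler_powR; rewrite ?nnegrE ?divr_ge0// ?(ltW d0)//.
  by rewrite ler_pdivrMr; lra.
nra.
Qed.

End power_sums.

Section weights.
Context {R : realType} {n : nat}.
Implicit Types (A w : 'I_n -> R) (rho : {perm 'I_n} -> R).

Lemma mean_perm_lnorm_le s A w : 1 < s -> (forall i, 0 <= A i) ->
    (forall k, 0 <= w k) ->
  mean (fun pi : {perm 'I_n} => lnorm s (fun i => A i * w (pi i))) <=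
    1 + \sum_i n%:R^-1 * \sum_k linpow s (A i * w k).
Proof.
move=> s1 A0 w0.
apply: (@le_trans _ _ (mean (fun pi : {perm 'I_n} =>
    1 + \sum_i linpow s (A i * w (pi i))))).
  by apply: le_mean => pi; apply: lnorm_le_linpow => // i; rewrite mulr_ge0.
rewrite meanD mean_perm_cst lerD2l mean_sum.
by apply: ler_sum => i _; rewrite (mean_perm_eval (fun k => linpow s (A i * w k))).
Qed.

Lemma mean_perm_lnorm_ge s A w (theta : R) : 1 < s -> (forall i, 0 <= A i) ->
    (forall k, 0 <= w k) -> 0 < theta <= 1 ->
    theta <= \sum_i n%:R^-1 * \sum_k linpow s (A i * w k) ->
  theta / (8 * s) <= mean (fun pi : {perm 'I_n} => lnorm s (fun i => A i * w (pi i))).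
Proof.
move=> s1 A0 w0 t01 h; have s0 : 0 < s by lra.
have Aw0 i k : 0 <= A i * w k by rewrite mulr_ge0.
have : theta / 8 <= mean (fun pi : {perm 'I_n} => s * lnorm s (fun i => A i * w (pi i))).
  apply: (@mean_perm_quadratic_ge _ _ (fun i k => linpow s (A i * w k))
    (fun i k => Num.min ((A i * w k) `^ s) 1)) => //.
  - by move=> i k; rewrite le_min powR_ge0 ler01.
  - move=> i k; rewrite /linpow; case: ifPn => [_|]; first by rewrite ge_min lexx.
    by rewrite -ltNge ge_min => v1; apply/orP; right; nra.
  - by rewrite mulr_sumr.
  - by move=> pi kappa k01; apply: lnorm_quadratic_ge.
rewrite meanZ -ler_pdivrMl//.
by rewrite (_ : s^-1 * _ = theta / (8 * s))//; field; rewrite gt_eqF.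
Qed.

Lemma sum_normalized_powR q A : 0 < q -> 0 < lnorm q A ->
  \sum_i (`|A i| / lnorm q A) `^ q = 1.
Proof.
move=> q0 L0; under eq_bigr do rewrite powR_div ?(ltW L0)//.
rewrite -mulr_suml -powR_lnorm// -powRD ?subrr ?powRr0//.
by rewrite (gt_eqF L0) implybT.
Qed.

(** The entries of [power_vector q n]. *)
Let power_weight q (k : 'I_n) : R := (n%:R / k.+1%:R) `^ q^-1.

(** For A normalised in l_q, coordinate i contributes a multiple of |A_i|^q to the
bound [mean_perm_lnorm_le], by [sum_linpow_power_le] with T = n |A_i|^q. *)
Lemma mean_perm_power_weights_le q s A : 1 < q -> q < s ->
  mean (fun pi : {perm 'I_n} => lnorm s (fun i => A i * power_weight q (pi i))) <=
    (1 + linpow_sum_const q s) * lnorm q A.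
Proof.
move=> q1 qs; have q0 : 0 < q by lra.
have s1 : 1 < s by lra. have s0 : 0 < s by lra.
have w0 k : 0 <= power_weight q k by exact: powR_ge0.
have := lnorm_ge0 q A; rewrite le_eqVlt => /predU1P[/esym L0|L0].
  rewrite L0 mulr0 -[leRHS](@mean_perm_cst R n); apply: le_mean => pi.
  rewrite lnorm_leP// powR0 ?gt_eqF// big1// => i _.
  have : `|A i| <= 0 by rewrite -L0 norm_le_lnorm.
  by rewrite normr_le0 => /eqP ->; rewrite mul0r normr0 powR0// gt_eqF.
set L := lnorm q A in L0 *.
pose B i := `|A i| / L.
have B0 i : 0 <= B i by rewrite divr_ge0// ltW.
have sB : \sum_i B i `^ q = 1 by exact: sum_normalized_powR.
have -> : (fun pi : {perm 'I_n} => lnorm s (fun i => A i * power_weight q (pi i))) =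
    (fun pi => L * lnorm s (fun i => B i * power_weight q (pi i))).
  apply/funext => pi.
  have -> : L * lnorm s (fun i => B i * power_weight q (pi i)) =
      lnorm s (fun i => L * (B i * power_weight q (pi i))).
    by rewrite lnormZ// (gtr0_norm L0).
  apply: eq_lnorm => i.
  by rewrite /B mulrA mulrCA mulfV ?gt_eqF// mulr1 !normrM normr_id.
rewrite meanZ mulrC ler_pM2r//.
apply: le_trans (mean_perm_lnorm_le _ _ _) _ => //.
have -> : linpow_sum_const q s = \sum_i linpow_sum_const q s * B i `^ q.
  by rewrite -mulr_sumr sB mulr1.
rewrite lerD2l; apply: ler_sum => i _.
have [n0|n0] := posnP n; first by move: (ltn_ord i); rewrite {2}n0.
have nr : 0 < n%:R :> R by rewrite ltr0n.
rewrite ler_pdivrMl//.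
have -> : \sum_k linpow s (B i * power_weight q k) =
    \sum_(0 <= k < n) linpow s ((n%:R * B i `^ q / k.+1%:R) `^ q^-1).
  rewrite big_mkord; apply: eq_bigr => k _; congr linpow.
  have -> : n%:R * B i `^ q / k.+1%:R = B i `^ q * (n%:R / k.+1%:R).
    by rewrite mulrCA mulrA.
  have nk0 : 0 <= n%:R / k.+1%:R :> R by rewrite divr_ge0.
  rewrite (powRM _ (powR_ge0 _ _) nk0) -powRrM mulfV ?gt_eqF//.
  by rewrite powRr1.
rewrite [leRHS]mulrCA; apply: sum_linpow_power_le => //.
by rewrite mulr_ge0 ?powR_ge0.
Qed.

Lemma le_card_ord (m : nat) (T : R) : (m <= n)%N -> m%:R <= T ->
  (m <= #|[set k : 'I_n | (k.+1%:R <= T)%R]|)%N.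
Proof.
move=> mn mT.
have inj : injective (widen_ord mn) by move=> i j /(congr1 val) /= /val_inj.
rewrite -[leqLHS]card_ord -(card_imset _ inj).
apply/subset_leq_card/fintype.subsetP => _ /imsetP[k _ ->]; rewrite inE /=.
by apply: le_trans mT; rewrite ler_nat.
Qed.

(** The weights are so heavy-tailed that the largest coordinate alone carries the
l_q-norm.  Let L = |A|_q and a_i = (|A_i| / L)^q, so that sum_i a_i = 1.  The
event k <= 2 n a_i forces |A_i| (n/k)^(1/q) >= L / 2^(1/q) >= L / 2. *)
Lemma mean_perm_power_weights_ge q A rho : 1 < q ->
    (forall pi, 0 <= rho pi) ->
    (forall (pi : {perm 'I_n}) i, `|A i| * power_weight q (pi i) <= rho pi) ->
  lnorm q A / 32 <= mean rho.
Proof.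
move=> q1 rho0 hrho; have q0 : 0 < q by lra.
have := lnorm_ge0 q A; rewrite le_eqVlt => /predU1P[<-|L0].
  by rewrite mul0r mean_ge0.
set L := lnorm q A in L0 *.
pose a i := (`|A i| / L) `^ q.
have a0 i : 0 <= a i by exact: powR_ge0.
have sa : \sum_i a i = 1 by exact: sum_normalized_powR.
have n0 : (0 < n)%N.
  rewrite lt0n; apply/eqP => n0; move: sa; rewrite big1 => [/esym/eqP|i _].
    by rewrite oner_eq0.
  by move: (ltn_ord i); rewrite {2}n0.
have a1 i : a i <= 1 by rewrite -sa (bigD1 i)//= lerDl sumr_ge0.
have nr : 0 < n%:R :> R by rewrite ltr0n.
have AE i : `|A i| = L * a i `^ q^-1.
  have AL0 : 0 <= `|A i| / L by rewrite divr_ge0// ltW.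
  by rewrite /a -powRrM mulfV ?gt_eqF// powRr1// mulrCA mulfV ?gt_eqF// mulr1.
have : 16^-1 <= mean (fun pi : {perm 'I_n} => (L / 2)^-1 * rho pi).
  apply: (@mean_perm_max_ge _ _ (fun i => [set k : 'I_n | k.+1%:R <= 2 * n%:R * a i])).
  - by move=> pi; rewrite mulr_ge0// invr_ge0; lra.
  - move=> pi i; rewrite inE => hk.
    rewrite ler_pdivlMl; last lra.
    rewrite mulr1; apply: le_trans (hrho pi i).
    rewrite AE -mulrA ler_pM2l// /power_weight -powRM//.
    have h2 : 2^-1 <= a i * (n%:R / (pi i).+1%:R).
      by rewrite mulrA ler_pdivlMr ?ltr0n//; lra.
    apply: (@le_trans _ _ (2^-1 `^ q^-1)).
      apply: ger1_powR; last by rewrite invf_le1// ltW.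
      lra.
    apply: ge0_ler_powR => //; rewrite ?nnegrE ?invr_ge0 ?(ltW q0)//.
    by rewrite mulr_ge0// divr_ge0.
  - rewrite ler_pdivlMl// natr_sum.
    have -> : n%:R / 2 = \sum_i (n%:R * a i) - n%:R / 2 :> R.
      by rewrite -mulr_sumr sa; lra.
    have -> : n%:R / 2 = \sum_(i < n) 2^-1 :> R.
      by rewrite sumr_const card_ord mulr_natl.
    (* at least n a_i - 1/2 of the n values k satisfy k <= 2 n a_i: the floor of
       2 n a_i loses at most half of it once it is >= 1, and below that the
       claim is trivial; the terms 1/2 add up to n / 2 only *)
    rewrite -sumrB; apply: ler_sum => i _.
    set T := 2 * n%:R * a i.
    have T0 : 0 <= T by rewrite !mulr_ge0.
    have /andP[T1 T2] := truncn_itv T0.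
    have := @le_card_ord (minn n (Num.truncn T)) T (geq_minl _ _).
    set c := #|_|; have [nT|nT] := leqP n (Num.truncn T).
      move=> /(_ (le_trans _ T1)); rewrite ler_nat => /(_ nT) nc.
      have : n%:R <= c%:R :> R by rewrite ler_nat.
      by have := a1 i; nra.
    move=> /(_ T1); case: (Num.truncn T) T2 => [|m] T2 mc.
      by have : 0 <= c%:R :> R by []; rewrite /T in T2; lra.
    have : m.+1%:R <= c%:R :> R by rewrite ler_nat.
    have : 0 <= m%:R :> R by [].
    move: T2; rewrite /T -(natr1 m.+1) -(natr1 m); lra.
rewrite meanZ invf_div -ler_pdivrMl; last by rewrite divr_gt0.
rewrite (_ : _^-1 * _ = L / 32)//; field.
by rewrite gt_eqF.
Qed.

End weights.

(** * The permutation average *)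

Section mixed_lnorm.
Context {R : realType} {I J : finType}.
Implicit Types (a : I -> J -> R) (w : J -> R) (r s : R).

(** Replacing the inner exponent by the smaller [r] makes the two sums
interchangeable. *)
Lemma lnorm_mixed_le r s a w : 0 < r -> r <= s ->
  lnorm r (fun i => lnorm s (fun j => a i j * w j)) <=
    lnorm r (fun j => lnorm r (a^~ j) * w j).
Proof.
move=> r0 rs.
apply: (@le_trans _ _ (lnorm r (fun i => lnorm r (fun j => a i j * w j)))).
  apply: (le_lnorm r0) => i.
  rewrite [leLHS](ger0_norm (lnorm_ge0 _ _)).
  rewrite [leRHS](ger0_norm (lnorm_ge0 _ _)).
  exact: lnorm_anti.
rewrite lnorm_leP ?lnorm_ge0// powR_lnorm//.
under eq_bigr do rewrite (ger0_norm (lnorm_ge0 _ _)) powR_lnorm//.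
rewrite exchange_big/=; apply: ler_sum => j _.
rewrite normrM (ger0_norm (lnorm_ge0 _ _)) (powRM _ (lnorm_ge0 _ _) (normr_ge0 _)).
rewrite powR_lnorm// mulr_suml.
by apply: ler_sum => i _; rewrite normrM powRM.
Qed.

Lemma lnorm_mixed_ge r s a w j : 0 < r -> 0 < s ->
  lnorm r (a^~ j) * `|w j| <= lnorm r (fun i => lnorm s (fun j => a i j * w j)).
Proof.
move=> r0 s0; have -> : lnorm r (a^~ j) * `|w j| = lnorm r (fun i => `|w j| * a i j).
  by rewrite (lnormZ _ _ r0) normr_id mulrC.
apply: (le_lnorm r0) => i; rewrite [leRHS](ger0_norm (lnorm_ge0 _ _)).
rewrite normrM normr_id mulrC -normrM.
exact: (norm_le_lnorm (fun j => a i j * w j)).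
Qed.

End mixed_lnorm.

Section permutation_average.
Context {R : realType} {n : nat}.
Implicit Types (x y z : 'rV[R]_n) (a : 'M[R]_n) (p r : R).

Lemma lnorm2E (I : finType) (v : I -> R) :
  lnorm 2 v = Num.sqrt (\sum_i `|v i| ^+ 2).
Proof.
rewrite -powR12_sqrt; last by apply: sumr_ge0 => i _; rewrite exprn_ge0.
by rewrite /lnorm; under eq_bigr do rewrite powR_mulrn//.
Qed.

Lemma permutation_averageE x y z a :
  permutation_average x y z a =
  mean (fun sigma : {perm 'I_n} => mean (fun eta : {perm 'I_n} =>
    mean (fun pi : {perm 'I_n} => lnorm 2 (fun i =>
      lnorm 2 (fun j => a i j * (y 0 (sigma j) * z 0 (eta j))) * x 0 (pi i))))).
Proof.
rewrite /permutation_average /mean card_perm_ord exchange_big/=.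
have -> : (n`!%:R ^+ 3)^-1 = n`!%:R^-1 * (n`!%:R^-1 * n`!%:R^-1) :> R.
  by rewrite -exprVn exprS expr2.
rewrite -mulrA; congr (_ * _); rewrite mulr_sumr; apply: eq_bigr => sigma _.
rewrite -mulrA; congr (_ * _); rewrite exchange_big mulr_sumr.
apply: eq_bigr => eta _; congr (_ * _); apply: eq_bigr => pi _.
rewrite lnorm2E; congr Num.sqrt; apply: eq_bigr => i _.
rewrite normrM exprMn (ger0_norm (lnorm_ge0 _ _)) lnorm2E sqr_sqrtr; last first.
  by apply: sumr_ge0 => j _; rewrite exprn_ge0.
rewrite mulr_suml; apply: eq_bigr => j _.
by rewrite -exprMn -normrM; congr (`|_| ^+ 2); ring.
Qed.

Definition column_norm r a (j : 'I_n) : R := lnorm r (fun i => a i j).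

Lemma column_norm_ge0 r a j : 0 <= column_norm r a j.
Proof. exact: lnorm_ge0. Qed.

(** What remains of the average once the heavy-tailed weights are integrated
out. *)
Definition averaged_lnorm p r y a : R :=
  mean (fun sigma : {perm 'I_n} => lnorm p (fun j => column_norm r a j * y 0 (sigma j))).

(** [pi] is averaged out with the exponents r < 2 and [eta] with p < r. *)
Lemma permutation_average_le p r y a : 1 < p -> p < r -> r < 2 ->
  permutation_average (power_vector r n) y (power_vector p n) a <=
  (1 + linpow_sum_const r 2) * (1 + linpow_sum_const p r) * averaged_lnorm p r y a.
Proof.
move=> p1 pr r2; have p0 : 0 < p by lra.
have r1 : 1 < r by lra. have r0 : 0 < r by lra.
have two0 : 0 < 2 :> R by [].
have C1 : 0 <= 1 + linpow_sum_const r 2 by rewrite addr_ge0 ?linpow_sum_const_ge0.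
rewrite permutation_averageE -mulrA -!meanZ; apply: le_mean => sigma.
pose w (eta : {perm 'I_n}) j := y 0 (sigma j) * (power_vector p n) 0 (eta j).
apply: (@le_trans _ _ (mean (fun eta : {perm 'I_n} => (1 + linpow_sum_const r 2) *
    lnorm r (fun j => (column_norm r a j * y 0 (sigma j)) *
      (n%:R / (eta j).+1%:R) `^ p^-1)))).
  apply: le_mean => eta.
  apply: (@le_trans _ _ ((1 + linpow_sum_const r 2) *
      lnorm r (fun i => lnorm 2 (fun j => a i j * w eta j)))).
    apply: le_trans (mean_perm_power_weights_le (fun i =>
      lnorm 2 (fun j => a i j * w eta j)) r1 r2).
    by apply: le_mean => pi; apply: (le_lnorm two0) => i; rewrite /w mxE.
  apply: (ler_wpM2l C1); apply: le_trans (lnorm_mixed_le _ _ r0 (ltW r2)) _.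
  by apply: (le_lnorm r0) => j; rewrite /w mxE mulrA.
rewrite meanZ; apply: (ler_wpM2l C1); exact: mean_perm_power_weights_le.
Qed.

(** The mean over [pi] leaves an l_r-norm, of which only the largest column is
kept; the weights of [eta] recover the l_p-norm from it. *)
Lemma permutation_average_ge p r y a : 1 < p -> p < r -> r < 2 ->
  averaged_lnorm p r y a / 32 ^+ 2 <=
  permutation_average (power_vector r n) y (power_vector p n) a.
Proof.
move=> p1 pr r2; have p0 : 0 < p by lra.
have r1 : 1 < r by lra. have r0 : 0 < r by lra.
rewrite permutation_averageE mulrC -meanZ; apply: le_mean => sigma.
pose w (eta : {perm 'I_n}) j := y 0 (sigma j) * (power_vector p n) 0 (eta j).
apply: (@le_trans _ _ (mean (fun eta : {perm 'I_n} => 32^-1 *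
    lnorm r (fun i => lnorm 2 (fun j => a i j * w eta j))))); last first.
  apply: le_mean => eta; rewrite mulrC; apply: mean_perm_power_weights_ge => //.
    by move=> pi; exact: lnorm_ge0.
  move=> pi i; rewrite (le_trans _ (norm_le_lnorm _ i _))//.
  by rewrite normrM mxE ler_wpM2l// ler_norm.
rewrite meanZ (_ : (32 ^+ 2)^-1 = 32^-1 * 32^-1); last by field.
rewrite -mulrA ler_pM2l; last by rewrite invr_gt0.
rewrite mulrC; apply: mean_perm_power_weights_ge => //.
  by move=> eta; exact: lnorm_ge0.
move=> eta j; apply: le_trans (lnorm_mixed_ge _ _ j r0 _) => //.
rewrite /w mxE !normrM (ger0_norm (column_norm_ge0 _ _ _)) -mulrA.
by rewrite ler_wpM2l ?column_norm_ge0// ler_wpM2l// ler_norm.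
Qed.

End permutation_average.

(** * The Orlicz function of a weight *)

Section luxemburg.
Context {R : realType} {n : nat}.
Implicit Types (M : R -> R) (v : 'rV[R]_n).

Lemma luxemburg_norm_ge0 M v : 0 <= luxemburg_norm M v.
Proof.
rewrite /luxemburg_norm; set S := (X in inf X).
have [S0|S0] := pselect (S !=set0)%classic.
  by apply: lb_le_inf => // rho [/ltW].
by rewrite inf_out// => -[/S0].
Qed.

(** Testing the sum on every [rho] below the norm replaces any continuity of [M]
at the norm itself. *)
Lemma luxemburg_norm_le M v c : 0 <= c ->
    (forall rho, 0 < rho -> 1 < \sum_j M (`|v 0 j| / rho) -> rho <= c) ->
  luxemburg_norm M v <= c.
Proof.
move=> c0 h; rewrite leNgt; apply/negP => clt.
pose rho := (c + luxemburg_norm M v) / 2.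
have rho0 : 0 < rho by rewrite /rho; lra.
have [rho1|rho1] := leP (\sum_j M (`|v 0 j| / rho)) 1.
  have : luxemburg_norm M v <= rho.
    by apply: ge_inf; [exists 0 => x [/ltW] | split].
  by rewrite /rho; lra.
by have := h _ rho0 rho1; rewrite /rho; lra.
Qed.

End luxemburg.

Section dual.
Context {R : realType}.
Implicit Types (M : R -> R).

Lemma dual_inverse_le M u t : orlicz_function M -> 0 <= u -> 0 < t ->
  dual_inverse M u <= (u + M t) / t.
Proof.
move=> [_ M0 Mgt0] u0 t0; apply: ge_sup.
  exists 0; split => //; apply: ge_ereal_sup => _ [s s0 <-].
  rewrite lee_fin mul0r sub0r (le_trans _ u0)// oppr_le0.
  by move: s0; rewrite /= le_eqVlt => /predU1P[<-|/Mgt0/ltW//]; rewrite M0.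
move=> s [s0 hs]; rewrite ler_pdivlMr// -lerBlDr -lee_fin.
by apply: le_trans hs; apply: ereal_sup_ubound; exists t => //=; exact: ltW.
Qed.

Lemma dual_inverse_ge M u s : orlicz_function M -> 0 <= u -> 0 <= s ->
  (forall t, 0 < t -> s * t <= u + M t) -> s <= dual_inverse M u.
Proof.
move=> oM u0 s0 h; have [_ M0 _] := oM; apply: ub_le_sup.
  exists ((u + M 1) / 1) => v [v0 hv].
  rewrite divr1 -[v]mulr1 -lerBlDr -lee_fin.
  by apply: le_trans hv; apply: ereal_sup_ubound; exists 1 => //=.
split => //; apply: ge_ereal_sup => _ [t /= t0 <-].
rewrite lee_fin lerBlDr; move: t0; rewrite le_eqVlt => /predU1P[<-|]; last exact: h.
by rewrite mulr0 M0 addr0.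
Qed.

End dual.

Section weight_orlicz.
Context {R : realType} {n : nat}.
Variables (p : R) (y : 'rV[R]_n).
Hypotheses (p1 : 1 < p) (y0 : forall i, 0 <= y 0 i) (yn0 : y != 0).

(** For B_j >= 0, sum_j M(B_j) is the mean over permutations of
sum_j psi_p(B_j y_{s(j)}), the quantity that governs the l_p-norm of
(B_j y_{s(j)})_j. *)
Definition weight_orlicz (t : R) : R := n%:R^-1 * \sum_i linpow p (t * y 0 i).
Local Notation M := weight_orlicz.

Let p0 : 0 < p.
Proof. exact: lt_trans p1. Qed.

Let n_gt0 : 0 < n%:R :> R.
Proof.
rewrite ltr0n lt0n; apply/eqP => n0.
by case/eqP: yn0; apply/rowP => i; move: (ltn_ord i); rewrite {2}n0.
Qed.

Let ex_y_gt0 : exists i, 0 < y 0 i.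
Proof.
have [//|none] := pselect (exists i, 0 < y 0 i).
case/eqP: yn0; apply/rowP => i; rewrite mxE; apply/eqP.
rewrite eq_le y0 andbT leNgt; apply/negP => yi; by case: none; exists i.
Qed.

Lemma weight_orlicz_ge0 t : 0 <= t -> 0 <= M t.
Proof.
move=> t0; rewrite mulr_ge0 ?invr_ge0// ?(ltW n_gt0)//; apply: sumr_ge0 => i _.
by apply: linpow_ge0 => //; rewrite mulr_ge0.
Qed.

Lemma weight_orlicz_convex l s t : 0 <= s -> 0 <= t -> 0 <= l <= 1 ->
  M (l * s + (1 - l) * t) <= l * M s + (1 - l) * M t.
Proof.
move=> s0 t0 l01; rewrite /M [X in _ <= X + _]mulrCA [X in _ <= _ + X]mulrCA -mulrDr.
rewrite ler_pM2l ?invr_gt0// !mulr_sumr -big_split/=; apply: ler_sum => i _.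
by rewrite mulrDl -!mulrA; apply: linpow_convex => //; rewrite mulr_ge0.
Qed.

Lemma weight_orlicz0 : M 0 = 0.
Proof.
by rewrite /M big1 ?mulr0// => i _; rewrite mul0r linpow0.
Qed.

Lemma orlicz_weight_orlicz : orlicz_function M.
Proof.
split; last 2 first.
- exact: weight_orlicz0.
- move=> t t0; rewrite /M mulr_gt0 ?invr_gt0//.
  have [i yi] := ex_y_gt0; rewrite (bigD1 i)//=.
  rewrite ltr_pwDl ?linpow_gt0 ?mulr_gt0//; apply: sumr_ge0 => j _.
  by apply: linpow_ge0 => //; rewrite mulr_ge0// ltW.
move=> l s t /[!inE] /= /[!in_itv] /= /[!andbT] s0 t0.
by rewrite convRE [X in M X <= _]convRE; apply: weight_orlicz_convex => //; apply/andP.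
Qed.

Section luxemburg_comparison.
Variable B : 'I_n -> R.
Hypothesis B0 : forall j, 0 <= B j.

Let avg := mean (fun sigma : {perm 'I_n} => lnorm p (fun j => B j * y 0 (sigma j))).

Let avgZ c : 0 <= c ->
  mean (fun sigma : {perm 'I_n} => lnorm p (fun j => c * B j * y 0 (sigma j))) = c * avg.
Proof.
move=> c0; rewrite -meanZ; congr mean; apply/funext => sigma.
rewrite -[X in X * _](ger0_norm c0) -(lnormZ _ _ p0); apply: eq_lnorm => j.
by rewrite mulrA.
Qed.

Let sumM rho : \sum_j M (`|(\row_j B j) 0 j| / rho) =
  \sum_j n%:R^-1 * \sum_k linpow p (rho^-1 * B j * y 0 k).
Proof. by apply: eq_bigr => j _; rewrite mxE ger0_norm// [_ / rho]mulrC. Qed.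

(** An infimum over an empty set would be 0, so an admissible [rho] has to be
exhibited first; for each admissible [rho] the mean of the norm of
(B_j y_{s(j)} / rho)_j is at most 1 + 1. *)
Lemma mean_le_luxemburg : avg <= 2 * luxemburg_norm M (\row_j B j).
Proof.
have avg_ge0 : 0 <= avg by apply: mean_ge0 => s; exact: lnorm_ge0.
rewrite -ler_pdivrMl//; apply: lb_le_inf.
  pose rho := Num.max 1 (\sum_j M (B j)).
  have rho1 : 1 <= rho by rewrite /rho le_max lexx.
  have rho0 : 0 < rho by lra.
  exists rho; split => //.
  apply: (@le_trans _ _ (\sum_j rho^-1 * M (B j))).
    apply: ler_sum => j _; rewrite mxE ger0_norm//.
    have := @weight_orlicz_convex rho^-1 (B j) 0 (B0 j) (lexx _).
    rewrite weight_orlicz0 !mulr0 !addr0 mulrC; apply.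
    by rewrite invr_ge0 (ltW rho0) invf_le1.
  by rewrite -mulr_sumr ler_pdivrMl// mulr1 le_max lexx orbT.
move=> rho [rho0]; rewrite sumM => h.
rewrite ler_pdivrMl// -ler_pdivrMr// mulrC -avgZ; last by rewrite invr_ge0 ltW.
apply: le_trans (mean_perm_lnorm_le _ _ _) _ => //.
  by move=> j; rewrite mulr_ge0// invr_ge0 ltW.
have -> : 2 = 1 + 1 :> R by [].
by rewrite lerD2l.
Qed.

Lemma luxemburg_le_mean :
  luxemburg_norm M (\row_j B j) <= 8 * p * avg.
Proof.
have avg_ge0 : 0 <= avg by apply: mean_ge0 => s; exact: lnorm_ge0.
apply: luxemburg_norm_le => [|rho rho0].
  by apply: mulr_ge0 avg_ge0; rewrite mulr_ge0 ?(ltW p0).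
rewrite sumM => /ltW h.
have rB0 j : 0 <= rho^-1 * B j by rewrite mulr_ge0// invr_ge0 ltW.
have l1 : 0 < (1 : R) <= 1 by rewrite ltr01 lexx.
have := mean_perm_lnorm_ge p1 rB0 y0 l1 h.
rewrite avgZ; last by rewrite invr_ge0 ltW.
rewrite ler_pdivrMr; last by rewrite mulr_gt0.
by rewrite -[_^-1 * _ * _]mulrA ler_pdivlMl// mulr1 [avg * _]mulrC.
Qed.

End luxemburg_comparison.

Lemma conjugate_exponentV : (conjugate_exponent p)^-1 = (p - 1) / p.
Proof.
have pn0 : p != 0 by rewrite gt_eqF.
have q0 : p / (p - 1) != 0 by rewrite mulf_neq0// invr_eq0 gt_eqF// subr_gt0.
have : (p%:E^-1 + (p / (p - 1))%:E^-1 = 1 :> \bar R)%E.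
  rewrite !inver (negbTE pn0) (negbTE q0) -EFinD invf_div; congr (_%:E); field.
  exact: pn0.
move=> /(hoelder_conjugateP _ (ltNyr _)) h.
by rewrite /conjugate_exponent -h ?eqe//= invf_div.
Qed.

Hypothesis ydec : forall i j : 'I_n, (i <= j)%N -> y 0 j <= y 0 i.

Section dual_comparison.
Variable l : nat.
Hypothesis ln : (1 <= l <= n)%N.

Let u : R := l%:R / n%:R.
Let T := dual_inverse_target p y l.
Let S := \sum_(i < n | (i < l)%N) y 0 i.
Let Q := n%:R^-1 * \sum_(i < n | (l <= i)%N) `|y 0 i| `^ p.

Let TE : T = n%:R^-1 * S + u `^ ((p - 1) / p) * Q `^ p^-1.
Proof. by rewrite /T /dual_inverse_target conjugate_exponentV. Qed.

Let u_gt0 : 0 < u.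
Proof. by case/andP: ln => l0 _; rewrite divr_gt0// ltr0n. Qed.

Let sum_split (F : 'I_n -> R) :
  \sum_i F i = \sum_(i < n | (i < l)%N) F i + \sum_(i < n | (l <= i)%N) F i.
Proof.
rewrite (bigID (fun i : 'I_n => (i < l)%N))/=; congr (_ + _).
by apply: eq_bigl => i; rewrite -leqNgt.
Qed.

Let sum_const (c : R) : \sum_(i < n | (i < l)%N) c = l%:R * c.
Proof.
by case/andP: ln => _ h; rewrite (big_ord_narrow h) sumr_const card_ord mulr_natl.
Qed.

Let Q_ge0 : 0 <= Q.
Proof.
by rewrite mulr_ge0 ?invr_ge0 ?ler0n//; apply: sumr_ge0 => i _; exact: powR_ge0.
Qed.

Let S_ge0 : 0 <= S.
Proof. by apply: sumr_ge0 => i _. Qed.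

Let T_gt0 : 0 < T.
Proof.
case/andP: ln => l0 h.
have n0 := leq_trans l0 h.
have [i yi] := ex_y_gt0.
have h0 : 0 < y 0 (Ordinal n0) by apply: lt_le_trans yi (ydec _).
rewrite TE ltr_pwDl// ?mulr_ge0 ?powR_ge0// mulr_gt0 ?invr_gt0//.
by rewrite /S (bigD1 (Ordinal n0))//= ltr_pwDl// sumr_ge0.
Qed.

(** The first summand of T comes from v <= 1 + psi_p(v).  For the second, put
c = (u + M(t)) / u.  An entry t y_i with i > l is at most the average of the l
largest ones, hence at most c, so [powR_le_linpow] gives
t^p Q <= M(t) c^(p-1), where Q is the p-th moment of the tail of y.  Since
u c = u + M(t), taking p-th roots yields t u^(1-1/p) Q^(1/p) <= u + M(t). *)
Lemma dual_inverse_target_le t : 0 < t -> T * t <= 2 * (u + M t).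
Proof.
move=> t0; have Mt0 := weight_orlicz_ge0 (ltW t0).
have ty0 i : 0 <= t * y 0 i by rewrite mulr_ge0// ltW.
have linpow_y_ge0 i : 0 <= linpow p (t * y 0 i) by exact: linpow_ge0.
have nM : n%:R * M t = \sum_i linpow p (t * y 0 i).
  by rewrite /M mulVKf// gt_eqF.
have nu : n%:R * u = l%:R by rewrite /u mulrC mulfVK// gt_eqF.
have hS : t * S <= n%:R * (u + M t).
  rewrite mulrDr nu nM sum_split -[l%:R]mulr1 -sum_const mulr_sumr addrA.
  rewrite -big_split/=; apply: ler_wpDr; first exact: sumr_ge0.
  by apply: ler_sum => i _; exact: linear_le_linpow.
have hS' : n%:R^-1 * S * t <= u + M t.
  by rewrite -mulrA ler_pdivrMl// [S * t]mulrC.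
pose c := (u + M t) / u.
have uc : u * c = u + M t by rewrite /c mulrC mulfVK// gt_eqF.
have c1 : 1 <= c by rewrite /c ler_pdivlMr// mul1r lerDl.
have yc (i : 'I_n) : (l <= i)%N -> t * y 0 i <= c.
  move=> li; rewrite -(ler_pM2l (mulr_gt0 n_gt0 u_gt0)) -[leRHS]mulrA uc.
  rewrite (le_trans _ hS)// nu -sum_const /S mulr_sumr; apply: ler_sum => j jl.
  by rewrite ler_pM2l// ydec// (leq_trans (ltnW jl)).
have hQ : t `^ p * Q <= M t * c `^ (p - 1).
  rewrite /M /Q mulrCA -mulrA ler_pM2l ?invr_gt0//.
  rewrite sum_split mulrDl.
  apply: ler_wpDl; first by rewrite mulr_ge0 ?powR_ge0 ?sumr_ge0.
  rewrite mulr_sumr mulr_suml; apply: ler_sum => i li.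
  rewrite ger0_norm// -powRM ?(ltW t0)//.
  by apply: powR_le_linpow => //; exact: yc.
have hQ' : u `^ ((p - 1) / p) * Q `^ p^-1 * t <= u + M t.
  have -> : u `^ ((p - 1) / p) * Q `^ p^-1 * t =
      u `^ ((p - 1) / p) * (t `^ p * Q) `^ p^-1.
    rewrite (powRM _ (powR_ge0 _ _) Q_ge0) -powRrM mulfV ?gt_eqF//.
    by rewrite powRr1 ?(ltW t0)// mulrA [RHS]mulrAC.
  apply: (@le_trans _ _ (u `^ ((p - 1) / p) * (M t * c `^ (p - 1)) `^ p^-1)).
    rewrite ler_wpM2l ?powR_ge0//; apply: ge0_ler_powR => //.
    - by rewrite invr_ge0 ltW.
    - by rewrite nnegrE mulr_ge0 ?powR_ge0.
    - by rewrite nnegrE mulr_ge0 ?powR_ge0.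
  have c0 : 0 <= c by lra.
  have uM : 0 < u + M t by rewrite ltr_pwDl.
  rewrite (powRM _ Mt0 (powR_ge0 _ _)) -powRrM mulrCA -(powRM _ (ltW u_gt0) c0) uc.
  rewrite [leRHS](_ : _ = (u + M t) `^ p^-1 * (u + M t) `^ ((p - 1) / p)); last first.
    have pp : p^-1 + (p - 1) / p = 1 by field; rewrite gt_eqF.
    by rewrite -powRD pp ?powRr1 ?(ltW uM)// oner_eq0.
  rewrite ler_wpM2r ?powR_ge0//; apply: ge0_ler_powR.
  - by rewrite invr_ge0 ltW.
  - by rewrite nnegrE.
  - by rewrite nnegrE ltW.
  - by rewrite lerDr ltW.
rewrite TE mulrDl; lra.
Qed.

Lemma target_le_dual_inverse : T <= 2 * dual_inverse M u.
Proof.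
rewrite -ler_pdivrMl// mulrC; apply: dual_inverse_ge.
- exact: orlicz_weight_orlicz.
- exact: ltW.
- by rewrite divr_ge0// ltW.
- by move=> t t0; have := dual_inverse_target_le t0; lra.
Qed.

(** At t = u / T the linear bound on psi_p for the l largest entries and the power
bound for the others give M(t) <= (p + 1) u. *)
Lemma dual_inverse_le_target : dual_inverse M u <= (2 + p) * T.
Proof.
pose t := u / T; have t0 : 0 < t by rewrite divr_gt0.
have tT : t * T = u by rewrite /t mulfVK// gt_eqF.
apply: le_trans (dual_inverse_le orlicz_weight_orlicz (ltW u_gt0) t0) _.
rewrite ler_pdivrMr// -mulrA [T * t]mulrC tT.
suff : M t <= p * u + u by lra.
have ty0 i : 0 <= t * y 0 i by rewrite mulr_ge0// ltW.
rewrite /M sum_split mulrDr; apply: lerD.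
  apply: (@le_trans _ _ (n%:R^-1 * (p * (t * S)))).
    rewrite ler_pM2l ?invr_gt0// /S !mulr_sumr; apply: ler_sum => i _.
    exact: linpow_le_linear.
  rewrite mulrCA ler_pM2l// mulrCA -tT ler_pM2l// TE lerDl.
  by rewrite mulr_ge0 ?powR_ge0.
apply: (@le_trans _ _ (t `^ p * Q)).
  rewrite /Q mulrCA ler_pM2l ?invr_gt0// mulr_sumr; apply: ler_sum => i _.
  rewrite ger0_norm// -powRM ?(ltW t0)//; exact: linpow_le_powR.
have hT : u `^ (p - 1) * Q <= T `^ p.
  have -> : u `^ (p - 1) * Q = (u `^ ((p - 1) / p) * Q `^ p^-1) `^ p.
    rewrite powRM ?powR_ge0// -!powRrM mulVf ?gt_eqF// powRr1//.
    by rewrite mulfVK// gt_eqF.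
  apply: ge0_ler_powR; rewrite ?nnegrE ?(ltW p0) ?(ltW T_gt0) ?mulr_ge0 ?powR_ge0//.
  by rewrite TE lerDr mulr_ge0// invr_ge0 ltW.
rewrite /t powR_div ?(ltW u_gt0) ?(ltW T_gt0)// powRN.
rewrite mulrAC ler_pdivrMr ?powR_gt0// -(mulr_powRB1 (ltW u_gt0) p0) -mulrA.
by rewrite ler_pM2l.
Qed.

End dual_comparison.

End weight_orlicz.

(** * Khintchine's inequality *)

Section moments.
Context {R : realType} {Omega : finType}.
Hypothesis Omega_gt0 : (0 < #|Omega|)%N.
Implicit Types (F : Omega -> R).

(** The variance of |F| is nonnegative. *)
Lemma sqr_mean_norm_le F : (mean (fun w => `|F w|)) ^+ 2 <= mean (fun w => F w ^+ 2).
Proof.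
set m := mean _.
have : 0 <= mean (fun w => (`|F w| - m) ^+ 2).
  by rewrite -(mean_cst 0 Omega_gt0); apply: le_mean => w; rewrite sqr_ge0.
have -> : mean (fun w => (`|F w| - m) ^+ 2) = mean (fun w => F w ^+ 2) - m ^+ 2.
  have -> : (fun w => (`|F w| - m) ^+ 2) =
      (fun w => F w ^+ 2 + (- (2 * m) * `|F w| + m ^+ 2)).
    by apply/funext => w; rewrite -(real_normK (num_real (F w))); ring.
  by rewrite meanD meanD meanZ mean_cst// -/m; ring.
by rewrite subr_ge0.
Qed.

(** Average t >= t^2 - (4/27) t^4 at t = |F| / D; the constant 4/27 makes the
difference t (2t/3 - 1)^2 (t/3 + 1). *)
Lemma mean_norm_ge F D : 0 <= D -> mean (fun w => F w ^+ 2) = D ^+ 2 ->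
  mean (fun w => F w ^+ 4) <= 3 * D ^+ 4 -> 5 / 9 * D <= mean (fun w => `|F w|).
Proof.
rewrite le_eqVlt => /predU1P[<- _ _|D0 h2 h4].
  by rewrite mulr0 -(mean_cst 0 Omega_gt0); apply: le_mean.
have key w : D^-1 * F w ^+ 2 - 4 / 27 * D^-1 ^+ 3 * F w ^+ 4 <= `|F w|.
  have -> : F w ^+ 2 = `|F w| ^+ 2 by rewrite real_normK ?num_real.
  have -> : F w ^+ 4 = `|F w| ^+ 4.
    by rewrite -[4%N]/(2 * 2)%N !exprM real_normK ?num_real.
  have -> : `|F w| = D * (`|F w| / D) by rewrite mulrC mulfVK// gt_eqF.
  set t := _ / D; have t0 : 0 <= t by rewrite divr_ge0// ltW.
  have -> : D^-1 * (D * t) ^+ 2 - 4 / 27 * D^-1 ^+ 3 * (D * t) ^+ 4 =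
      D * (t ^+ 2 - 4 / 27 * t ^+ 4) by field; rewrite gt_eqF.
  rewrite ler_pM2l// -subr_ge0.
  have -> : t - (t ^+ 2 - 4 / 27 * t ^+ 4) = t * ((2 / 3 * t - 1) ^+ 2 * (t / 3 + 1)).
    by field.
  by rewrite mulr_ge0// mulr_ge0 ?sqr_ge0//; lra.
apply: le_trans (le_mean key).
have -> : (fun w => D^-1 * F w ^+ 2 - 4 / 27 * D^-1 ^+ 3 * F w ^+ 4) =
    (fun w => D^-1 * F w ^+ 2 + (- (4 / 27 * D^-1 ^+ 3)) * F w ^+ 4).
  by apply/funext => w; rewrite mulNr.
rewrite meanD !meanZ h2 mulNr.
have c0 : 0 <= 4 / 27 * D^-1 ^+ 3 by rewrite mulr_ge0// exprn_ge0// invr_ge0 ltW.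
have : 4 / 27 * D^-1 ^+ 3 * mean (fun w => F w ^+ 4) <=
    4 / 27 * D^-1 ^+ 3 * (3 * D ^+ 4) by rewrite ler_wpM2l.
have -> : 4 / 27 * D^-1 ^+ 3 * (3 * D ^+ 4) = 4 / 9 * D by field; rewrite gt_eqF.
have -> : D^-1 * D ^+ 2 = D by field; rewrite gt_eqF.
lra.
Qed.

End moments.

Section rademacher.
Context {R : realType}.

Lemma mean_bool_pair (Omega : finType) (F : bool * Omega -> R) :
  mean F = 2^-1 * (mean (fun w => F (true, w)) + mean (fun w => F (false, w))).
Proof.
rewrite /mean card_prod card_bool natrM invfM -mulrA; congr (_ * _).
rewrite -mulrDr; congr (_ * _).
have -> : \sum_w F w = \sum_(b : bool) \sum_w F (b, w).
  by rewrite pair_bigA; apply: eq_bigr => -[].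
by rewrite big_bool.
Qed.

(** The [eps i] with i < N are independent signs.  They are added one at a time, so
that the moments only need the average over the last sign.  Indexing by [nat]
rather than by an ordinal spares the induction a change of index type. *)
Lemma rademacher_exists (N : nat) :
  exists (Omega : finType) (eps : nat -> Omega -> R), (0 < #|Omega|)%N /\
    forall v : nat -> R,
      let X w := \sum_(i < N) v i * eps i w in
      let D := \sum_(i < N) v i ^+ 2 in
      mean (fun w => X w ^+ 2) = D /\ mean (fun w => X w ^+ 4) <= 3 * D ^+ 2.
Proof.
elim: N => [|N [W [eps [W0 IH]]]].
  exists unit, (fun _ _ => 0); split; first by rewrite card_unit.
  move=> v X D; have X0 w : X w = 0 by rewrite /X big_ord0.
  have -> : D = 0 by rewrite /D big_ord0.
  rewrite /mean !big1 ?mulr0 ?expr0n// => w _; by rewrite X0 expr0n.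
exists (bool * W)%type,
  (fun i (w : bool * W) => if i == N then (-1) ^+ w.1 else eps i w.2).
split; first by rewrite card_prod card_bool muln_gt0.
move=> v X D.
pose Y w := \sum_(i < N) v i * eps i w; pose E := \sum_(i < N) v i ^+ 2.
have [h2 h4] : mean (fun w => Y w ^+ 2) = E /\ mean (fun w => Y w ^+ 4) <= 3 * E ^+ 2.
  exact: IH.
have XE b w : X (b, w) = Y w + v N * (-1) ^+ b.
  rewrite /X big_ord_recr/= eqxx; congr (_ + _); apply: eq_bigr => i _.
  by rewrite ltn_eqF.
have DE : D = E + v N ^+ 2 by rewrite /D big_ord_recr.
have E0 : 0 <= E by apply: sumr_ge0 => i _; rewrite sqr_ge0.
rewrite !mean_bool_pair -!meanD.
set c := v N in XE DE.
have s2 w : X (true, w) ^+ 2 + X (false, w) ^+ 2 = 2 * (Y w ^+ 2) + 2 * c ^+ 2.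
  by rewrite !XE/=; ring.
have s4 w : X (true, w) ^+ 4 + X (false, w) ^+ 4 =
    2 * (Y w ^+ 4) + (12 * c ^+ 2 * (Y w ^+ 2) + 2 * c ^+ 4).
  by rewrite !XE/=; ring.
rewrite (funext s2) (funext s4) !meanD !meanZ !mean_cst// h2 DE.
split; first by field.
have c4 : 0 <= c ^+ 4 by rewrite -[4%N]/(2 * 2)%N exprM sqr_ge0.
have -> : 3 * (E + c ^+ 2) ^+ 2 = 3 * E ^+ 2 + 6 * c ^+ 2 * E + 3 * c ^+ 4 by ring.
have -> : 2^-1 * (2 * mean (fun w => Y w ^+ 4) + (12 * c ^+ 2 * E + 2 * c ^+ 4)) =
   mean (fun w => Y w ^+ 4) + 6 * c ^+ 2 * E + c ^+ 4 by field.
lra.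
Qed.

(** The second moment gives the upper bound, the fourth moment the lower one. *)
Lemma khintchine (I : finType) :
  exists (Omega : finType) (eps : I -> Omega -> R), (0 < #|Omega|)%N /\
    forall v : I -> R,
      5 / 9 * Num.sqrt (\sum_i v i ^+ 2) <= mean (fun w => `|\sum_i v i * eps i w|)
      /\ mean (fun w => `|\sum_i v i * eps i w|) <= Num.sqrt (\sum_i v i ^+ 2).
Proof.
have [W [eps [W0 h]]] := rademacher_exists #|I|.
exists W, (fun i => eps (enum_rank i)); split => // v.
(* v read along the enumeration of I and extended by 0 *)
pose u k := if insub k is Some j then v (@enum_val I I j) else 0.
have uE (G : I -> R) (H : nat -> R) : (forall j, G (@enum_val I I j) = H (val j)) ->
    \sum_i G i = \sum_(k < #|I|) H k.
  move=> GH; rewrite (reindex _ (onW_bij _ (@enum_val_bij I))).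
  by apply: eq_bigr => k _; exact: GH.
have [h2 h4] := h u.
have uv (k : 'I_#|I|) : u (val k) = v (@enum_val I I k) by rewrite /u valK.
have D0 : 0 <= \sum_i v i ^+ 2 by apply: sumr_ge0 => i _; rewrite sqr_ge0.
have sE : \sum_i v i ^+ 2 = \sum_(k < #|I|) u k ^+ 2.
  by apply: (uE (fun i => v i ^+ 2) (fun k => u k ^+ 2)) => k; rewrite uv.
have XE w : \sum_i v i * eps (enum_rank i) w = \sum_(k < #|I|) u k * eps k w.
  apply: (uE (fun i => v i * eps (enum_rank i) w) (fun k => u k * eps k w)) => k.
  by rewrite uv enum_valK.
have -> : (fun w => `|\sum_i v i * eps (enum_rank i) w|) =
    (fun w => `|\sum_(k < #|I|) u k * eps k w|).
  by apply/funext => w; rewrite XE.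
split.
  apply: (mean_norm_ge W0); first exact: sqrtr_ge0.
    by rewrite h2 sqr_sqrtr// sE.
  by rewrite (le_trans h4)// -[4%N]/(2 * 2)%N exprM sqr_sqrtr// sE.
rewrite -(ler_pXn2r (n := 2))// ?nnegrE ?sqrtr_ge0//; last first.
  by rewrite -[leLHS](mean_cst _ W0); apply: le_mean.
by rewrite sqr_sqrtr// (le_trans (sqr_mean_norm_le W0 _))// h2 sE.
Qed.

End rademacher.

(** * Embedding into L_1 *)

Section step_functions.
Local Open Scope classical_set_scope.
Context {R : realType} {Omega : finType}.
Hypothesis Omega_gt0 : (0 < #|Omega|)%N.
Implicit Types (F : Omega -> R) (w : Omega).
Local Notation mu := (lebesgue01 R).
Local Notation N := (#|Omega|%:R : R).

(** [0, 1) is cut into equally long intervals, one for each point of [Omega]. *)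
Definition cell w : set (measurableTypeR R) :=
  `[(enum_rank w)%:R / N, (enum_rank w).+1%:R / N[.

Let N_gt0 : 0 < N.
Proof. by rewrite ltr0n. Qed.

Lemma measurable_cell w : measurable (cell w).
Proof. exact: measurable_itv. Qed.

Lemma mu_cell w : mu (cell w) = N^-1%:E.
Proof.
have -> : mu (cell w) = @lebesgue_measure R (cell w `&` `[0, 1]) by [].
rewrite setIidl; last first.
  move=> t; rewrite /cell /= !in_itv/= => /andP[h1 h2]; apply/andP; split.
    by apply: (le_trans _ h1); rewrite divr_ge0// ltW.
  apply: le_trans (ltW h2) _; rewrite ler_pdivrMr// mul1r ler_nat.
  exact: ltn_ord.
rewrite lebesgue_measure_itv/= lte_fin ltr_pM2r ?invr_gt0// ltr_nat ltnSn.
by rewrite -EFinB -mulrBl -natr1 addrAC subrr add0r mul1r.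
Qed.

Lemma cell_inj w w' t : cell w t -> cell w' t -> w = w'.
Proof.
rewrite /cell /= !in_itv/= => /andP[a1 a2] /andP[b1 b2].
apply: enum_rank_inj; apply: val_inj; apply/eqP; rewrite eqn_leq /=.
have := le_lt_trans a1 b2; have := le_lt_trans b1 a2.
by rewrite !ltr_pM2r ?invr_gt0// !ltr_nat !ltnS => -> ->.
Qed.

Definition step F (t : measurableTypeR R) : R := \sum_w F w * \1_(cell w) t.

Lemma norm_step F t : `|step F t| = step (fun w => `|F w|) t.
Proof.
rewrite /step; have [[w tw]|none] := pselect (exists w, cell w t).
  have z G : \sum_w' G w' * \1_(cell w') t = G w :> R.
    rewrite (bigD1 w)//= big1 ?addr0 ?indicE ?mem_set ?mulr1// => w' w'w.
    rewrite indicE memNset ?mulr0// => tw'.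
    by move: w'w; rewrite (cell_inj tw' tw) eqxx.
  by rewrite !z.
have z G : \sum_w' G w' * \1_(cell w') t = 0 :> R.
  by apply: big1 => w _; rewrite indicE memNset ?mulr0// => tw; case: none; exists w.
by rewrite !z normr0.
Qed.

Lemma step_Lfun F : step F \in Lfun mu 1.
Proof.
apply/Lfun1_integrable.
have -> : EFin \o step F = (fun t => \sum_w (F w)%:E * (\1_(cell w) t)%:E)%E.
  by apply/funext => t /=; rewrite -sumEFin; apply: eq_bigr => w _; rewrite EFinM.
apply: integrable_sum => // w _; apply: integrableZl => //.
apply/integrableP; split.
  by apply/measurable_EFinP; apply: measurable_indic; exact: measurable_cell.
under eq_integral do rewrite gee0_abs ?lee_fin//.
by rewrite integral_indic ?setIT ?[X in (X < _)%E]mu_cell ?ltry//; exact: measurable_cell.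
Qed.

Lemma integral_norm_step F :
  (\int[mu]_t `|(step F t)%:E|)%E = (mean (fun w => `|F w|))%:E.
Proof.
have -> : (\int[mu]_t `|(step F t)%:E|)%E =
    (\int[mu]_t \sum_w (`|F w|)%:E * (\1_(cell w) t)%:E)%E.
  apply: eq_integral => t _; rewrite abse_EFin norm_step -sumEFin.
  by apply: eq_bigr => w _; rewrite EFinM.
have mI w : measurable_fun [set: measurableTypeR R]
    (fun t => (\1_(cell w) t : R)%:E).
  by apply/measurable_EFinP; apply: measurable_indic; exact: measurable_cell.
rewrite ge0_integral_sum//.
- rewrite /mean mulr_sumr -sumEFin; apply: eq_bigr => w _.
  rewrite ge0_integralZl_EFin//.
  + rewrite integral_indic// ?setIT; [|exact: measurable_cell].
    by rewrite [X in (_ * X)%E](mu_cell w) -EFinM mulrC.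
- move=> w; apply: measurable_funeM; exact: mI.
Qed.

Definition L1_step F : L1_01 R := L1_of (step_Lfun F).

Lemma L1_norm_step F : @L1_norm _ _ _ mu (L1_step F) = mean (fun w => `|F w|).
Proof.
rewrite /L1_norm Lnorm1.
suff -> : (\int[mu]_t `|(EFin \o L1_fun (L1_step F)) t| =
    \int[mu]_t `|(step F t)%:E|)%E by rewrite integral_norm_step.
have m (f : measurableTypeR R -> R) : f \in Lfun mu 1 ->
    measurable_fun setT (fun t => `|(f t)%:E|%E).
  move=> fL; apply: measurableT_comp => //; apply/measurable_EFinP.
  exact: (set_mem (sub_Lfun_mfun fL)).
apply: ae_eq_integral => //.
- apply: (m (L1_fun (L1_step F))); exact: L1_fun_Lfun.
- apply: m; exact: step_Lfun.
- by apply: filterS (L1_ofE (step_Lfun F)) => t /[apply] /= ->.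
Qed.

Section embedding.
Variables (V : lmodType R) (F : V -> Omega -> R).
Hypothesis F_linear : forall a u v w, F (a *: u + v) w = a * F u w + F v w.

Definition L1_embedding (v : V) : L1_01 R := L1_step (F v).

Lemma L1_embedding_linear : linear L1_embedding.
Proof.
move=> a u v; apply/L1_eqP; near=> t => _.
rewrite (near (L1_ofE (step_Lfun (F (a *: u + v)))) t)//.
rewrite (near (L1_addE (a *: L1_embedding u : L1 mu) (L1_embedding v)) t)//=.
rewrite (near (L1_scaleE a (L1_embedding u)) t)//.
rewrite (near (L1_ofE (step_Lfun (F u))) t)// (near (L1_ofE (step_Lfun (F v))) t)//.
rewrite /step mulr_sumr -big_split/=; apply: eq_bigr => w _.
by rewrite F_linear mulrDl mulrA.
Unshelve. all: by end_near. Qed.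

HB.instance Definition _ :=
  GRing.isLinear.Build R V (L1_01 R) _ L1_embedding L1_embedding_linear.

(** The two-sided estimate bounds the operator norms of the embedding and of its
inverse by [b] and [1 / a]. *)
Lemma isomorphic_to_subspace_L1 (NV : V -> R) (a b : R) : 0 < a -> 0 <= b ->
    (forall v, 0 <= NV v) ->
    (forall v, a * NV v <= mean (fun w => `|F v w|)) ->
    (forall v, mean (fun w => `|F v w|) <= b * NV v) ->
    (forall v, (forall w, F v w = 0) -> v = 0) ->
  isomorphic_to_subspace (b / a) NV (@L1_norm _ _ _ mu).
Proof.
move=> a0 b0 NV0 lo hi inj.
pose I : {linear V -> L1_01 R} := L1_embedding.
have normI v : @L1_norm _ _ _ mu (I v) = mean (fun w => `|F v w|).
  exact: L1_norm_step.
have NV00 : NV 0 = 0.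
  apply/eqP; rewrite eq_le NV0 andbT -(ler_pM2l a0) mulr0.
  apply: le_trans (lo 0) _; rewrite /mean big1 ?mulr0// => w _.
  suff -> : F 0 w = 0 by rewrite normr0.
  have := F_linear 1 0 0 w; rewrite scaler0 addr0 mul1r => h.
  by apply: (addrI (F 0 w)); rewrite addr0 -h.
have I_inj : injective I.
  move=> u v uv; apply/eqP; rewrite -subr_eq0; apply/eqP/inj => w.
  have h : mean (fun w => `|F (u - v) w|) = 0.
    rewrite -normI linearB uv subrr -(linear0 I) normI; apply/eqP.
    rewrite eq_le (le_trans (hi 0)) ?NV00 ?mulr0//=.
    by rewrite mulr_ge0 ?invr_ge0 ?sumr_ge0.
  move: h => /eqP; rewrite mulf_eq0 invr_eq0 gt_eqF//= psumr_eq0//.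
  by move=> /allP /(_ w (mem_index_enum _)) /=; rewrite normr_eq0 => /eqP.
pose J (w : L1_01 R) : V := xget 0 [set v | I v = w].
have IJ : cancel I J.
  move=> v; rewrite /J; case: xgetP => [u _ /I_inj//|none].
  by have := none v erefl.
exists (range I); split.
  split; first by exists 0 => //; exact: linear0.
  move=> c _ _ [u _ <-] [v _ <-]; exists (c *: u + v) => //.
  exact: linearP.
have hI : (opnorm NV (@L1_norm _ _ _ mu) setT I <= b%:E)%E.
  apply: ge_ereal_sup => _ [v [_ v1] <-]; rewrite lee_fin normI.
  by apply: le_trans (hi v) _; rewrite -[leRHS]mulr1 ler_wpM2l.
have hJ : (opnorm (@L1_norm _ _ _ mu) NV (range I) J <= a^-1%:E)%E.
  apply: ge_ereal_sup => _ [_ [[v _ <-] v1] <-]; rewrite lee_fin IJ.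
  by rewrite -(ler_pM2l a0) mulfV ?gt_eqF// (le_trans (lo v))// -normI.
exists I, J; split => //.
- exact: le_lt_trans hI (ltry _).
- exact: le_lt_trans hJ (ltry _).
- rewrite EFinM; apply: lee_pmul => //.
  (* the vector 0 shows that both operator norms are nonnegative *)
  + apply: le_ereal_sup_tmp; exists (L1_norm (I 0))%:E.
      by exists 0 => //; split => //; rewrite /= NV00.
    by rewrite lee_fin normI mulr_ge0 ?invr_ge0 ?sumr_ge0.
  + apply: le_ereal_sup_tmp; exists (NV (J (I 0)))%:E; last by rewrite lee_fin.
    exists (I 0) => //; split; first by exists 0.
    by rewrite normI (le_trans (hi 0)) ?NV00 ?mulr0.
Qed.

End embedding.

End step_functions.

(** * The permutation average as an L_1-norm *)

Section assembly.
Context {R : realType} {n : nat}.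
Variables (p r : R) (y : 'rV[R]_n).
Hypotheses (p1 : 1 < p) (pr : p < r) (r2 : r < 2).
Hypotheses (y0 : forall i, 0 <= y 0 i) (yn0 : y != 0).
Local Notation M := (weight_orlicz p y).
Local Notation x := (power_vector r n).
Local Notation z := (power_vector p n).
Implicit Type a : 'M[R]_n.

Lemma mixed_normE (N : R -> R) a :
  mixed_norm N r a = luxemburg_norm N (\row_j column_norm r a j).
Proof.
have <- : \row_j lr_norm r (\row_i a i j) = \row_j column_norm r a j.
  apply/rowP => j; rewrite [LHS]mxE [RHS]mxE /lr_norm.
  by under eq_bigr do rewrite mxE.
exact: erefl.
Qed.

Lemma mixed_norm_le_permutation_average a :
  (8 * p * 32 ^+ 2)^-1 * mixed_norm M r a <= permutation_average x y z a.
Proof.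
apply: le_trans (permutation_average_ge y a p1 pr r2).
have p0 : 0 < p := lt_trans ltr01 p1.
have := luxemburg_le_mean p1 y0 (column_norm_ge0 r a).
rewrite -mixed_normE -/(averaged_lnorm p r y a) => h.
rewrite mulrC invfM mulrA ler_pM2r ?invr_gt0 ?exprn_gt0//.
by rewrite ler_pdivrMr ?mulr_gt0// mulrC.
Qed.

Lemma permutation_average_le_mixed_norm a :
  permutation_average x y z a <=
  2 * ((1 + linpow_sum_const r 2) * (1 + linpow_sum_const p r)) * mixed_norm M r a.
Proof.
apply: le_trans (permutation_average_le y a p1 pr r2) _.
have C0 : 0 <= (1 + linpow_sum_const r 2) * (1 + linpow_sum_const p r).
  by rewrite mulr_ge0// addr_ge0// linpow_sum_const_ge0// (lt_trans p1).
have := mean_le_luxemburg p1 y0 yn0 (column_norm_ge0 r a).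
rewrite -mixed_normE -/(averaged_lnorm p r y a) => h.
by rewrite -[leRHS]mulrA [leRHS]mulrCA; exact: ler_wpM2l.
Qed.

Let triple := ({perm 'I_n} * {perm 'I_n} * {perm 'I_n})%type.

Let coef (s : triple) (ij : 'I_n * 'I_n) : R :=
  x 0 (s.1.1 ij.1) * y 0 (s.1.2 ij.2) * z 0 (s.2 ij.2).

Lemma permutation_average_mean a : permutation_average x y z a =
  mean (fun s : triple => Num.sqrt (\sum_ij (a ij.1 ij.2 * coef s ij) ^+ 2)).
Proof.
rewrite /permutation_average /mean !card_prod.
rewrite card_perm_ord !natrM -!expr2 -exprSr; congr (_ * _).
rewrite pair_bigA pair_bigA; apply: eq_bigr => s _ /=.
congr Num.sqrt; rewrite pair_bigA; apply: eq_bigr => ij _ /=.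
by rewrite real_normK ?num_real// /coef !mulrA.
Qed.

(** Makes the embedding injective: no entry of a matrix is killed by every triple
of permutations. *)
Lemma coef_neq0 i j : exists s, coef s (i, j) != 0.
Proof.
have n0 : 0 < n%:R :> R by rewrite ltr0n (leq_ltn_trans _ (ltn_ord i)).
have [k yk] : exists k, y 0 k != 0.
  by have /rV0Pn[k yk] := yn0; exists k.
exists (1%g, tperm j k, 1%g); rewrite /coef /= tpermL !perm1 !mxE.
have w q (k' : 'I_n) : (n%:R / k'.+1%:R) `^ q^-1 != 0 :> R.
  by rewrite gt_eqF// powR_gt0// divr_gt0.
by rewrite mulf_neq0 ?mulf_neq0.
Qed.

Lemma isomorphic_to_subspace_mixed_norm (alpha beta : R) : 0 < alpha -> 0 <= beta ->
    (forall a, alpha * mixed_norm M r a <= permutation_average x y z a) ->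
    (forall a, permutation_average x y z a <= beta * mixed_norm M r a) ->
  @isomorphic_to_subspace R (beta / (5 / 9 * alpha)) 'M[R]_n (L1_01 R)
    (@mixed_norm R M r n) (@L1_norm _ _ _ (lebesgue01 R)).
Proof.
move=> a0 b0 lo hi.
have [W [eps [W0 khin]]] := @khintchine R ('I_n * 'I_n)%type.
have triple0 : (0 < #|{: triple}|)%N by apply/card_gt0P; exists (1%g, 1%g, 1%g).
pose F (a : 'M[R]_n) (sw : triple * W) : R :=
  \sum_ij a ij.1 ij.2 * coef sw.1 ij * eps ij sw.2.
have meanF a : mean (fun sw => `|F a sw|) =
    mean (fun s => mean (fun w => `|\sum_ij a ij.1 ij.2 * coef s ij * eps ij w|)).
  exact: mean_prod.
have khin_lo s a := (khin (fun ij => a ij.1 ij.2 * coef s ij)).1.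
have khin_hi s a := (khin (fun ij => a ij.1 ij.2 * coef s ij)).2.
have loF a : 5 / 9 * permutation_average x y z a <= mean (fun sw => `|F a sw|).
  by rewrite meanF permutation_average_mean -meanZ; apply: le_mean.
apply: (@isomorphic_to_subspace_L1 _ _ _ _ F).
- by rewrite card_prod muln_gt0 triple0.
- move=> c u v sw; rewrite /F mulr_sumr -big_split/=; apply: eq_bigr => ij _.
  by rewrite !mxE; ring.
- by rewrite mulr_gt0.
- by [].
- by move=> a; rewrite mixed_normE luxemburg_norm_ge0.
- move=> a; apply: le_trans (loF a); rewrite -[leLHS]mulrA.
  by apply: ler_wpM2l (lo a); rewrite divr_ge0.
- move=> a; apply: le_trans (hi a).
  by rewrite meanF permutation_average_mean; apply: le_mean.
move=> a Fa; apply/matrixP => i j; rewrite mxE.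
have [s cs] := coef_neq0 i j.
have : Num.sqrt (\sum_ij (a ij.1 ij.2 * coef s ij) ^+ 2) <= 0.
  have m0 : mean (fun w => `|\sum_ij a ij.1 ij.2 * coef s ij * eps ij w|) = 0.
    rewrite /mean big1 ?mulr0// => w _; have Fsw : F a (s, w) = 0 by exact: Fa.
    by rewrite /F /= in Fsw; rewrite Fsw normr0.
  by have := khin_lo s a; rewrite m0 pmulr_rle0.
move=> h0.
have h : \sum_ij (a ij.1 ij.2 * coef s ij) ^+ 2 <= 0.
  by rewrite -sqrtr_eq0 eq_le h0 sqrtr_ge0.
have sq0 (ij : 'I_n * 'I_n) : true -> 0 <= (a ij.1 ij.2 * coef s ij) ^+ 2.
  by rewrite sqr_ge0.
have /eqP : \sum_ij (a ij.1 ij.2 * coef s ij) ^+ 2 = 0.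
  by apply/eqP; rewrite eq_le h sumr_ge0.
rewrite psumr_eq0// => /allP /(_ (i, j) (mem_index_enum _)) /=.
by rewrite sqrf_eq0 mulf_eq0 (negbTE cs) orbF => /eqP.
Qed.

End assembly.

Theorem proposition3p1 (R : realType) (p r : R) (hp : 1 < p) (hpr : p < r)
    (hr : r < 2) :
  exists c1 c2 a_rp b_rp D_rp : R,
    [/\ 0 < c1, 0 < c2, 0 < a_rp, 0 < b_rp & 0 < D_rp] /\
    forall (n : nat) (y : 'rV[R]_n),
      y != 0 ->
      (forall i j : 'I_n, (i <= j)%N -> y 0 j <= y 0 i) ->
      (forall i : 'I_n, 0 <= y 0 i) ->
      let x := power_vector r n in
      let z := power_vector p n in
      exists M : R -> R,
        [/\ orlicz_function M,
            forall l : nat, (1 <= l <= n)%N ->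
              c1 * dual_inverse M (l%:R / n%:R) <= dual_inverse_target p y l
              /\ dual_inverse_target p y l <= c2 * dual_inverse M (l%:R / n%:R),
            forall a : 'M[R]_n,
              a_rp * mixed_norm M r a <= permutation_average x y z a
              /\ permutation_average x y z a <= b_rp * mixed_norm M r a
          & @isomorphic_to_subspace R D_rp 'M[R]_n (L1_01 R)
              (@mixed_norm R M r n) (@L1_norm _ _ _ (lebesgue01 R))].
Proof.
pose alpha := (8 * p * 32 ^+ 2)^-1.
pose beta := 2 * ((1 + linpow_sum_const r 2) * (1 + linpow_sum_const p r)).
have p0 : 0 < p by lra.
have alpha0 : 0 < alpha by rewrite invr_gt0 !mulr_gt0 ?exprn_gt0.
have r1 : 1 < r by exact: lt_trans hpr.
have C1 : 0 < 1 + linpow_sum_const r 2 by rewrite ltr_pwDl// linpow_sum_const_ge0.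
have C2 : 0 < 1 + linpow_sum_const p r by rewrite ltr_pwDl// linpow_sum_const_ge0.
have beta0 : 0 < beta by rewrite !mulr_gt0.
have D0 : 0 < beta / (5 / 9 * alpha) by rewrite divr_gt0// mulr_gt0.
exists (2 + p)^-1, 2, alpha, beta, (beta / (5 / 9 * alpha)); split.
  by split=> //; rewrite invr_gt0 addr_gt0.
move=> n y yn0 ydec y0 x z; exists (weight_orlicz p y).
split.
- exact: orlicz_weight_orlicz.
- move=> l ln; split; last exact: target_le_dual_inverse.
  by rewrite ler_pdivrMl; [exact: dual_inverse_le_target|rewrite addr_gt0].
- move=> a; split; first exact: mixed_norm_le_permutation_average.
  exact: permutation_average_le_mixed_norm.
- apply: isomorphic_to_subspace_mixed_norm => //; first exact: ltW.
    by move=> a; exact: mixed_norm_le_permutation_average.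
  by move=> a; exact: permutation_average_le_mixed_norm.
Qed.
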